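(* Let $1\le k\le n$ be integers, let $\mathcal{J}\subset\binom{[n]}{k}$ be a maximal (by inclusion) arrangement of largest minors in $Gr^+(k,n)$, and let $W\in\binom{[n]}{k}$ with $W\notin\mathcal{J}$. The following two statements are equivalent. (1) $W$ is a $(2,\mathcal{J})$-largest minor. (2) There exists a vertex $\mathcal{Q}$ of $\Gamma_{(k,n)}$ that is adjacent to $\mathcal{J}$ and such that $W\in\mathcal{Q}$. In particular, the $(2,\mathcal{J})$-largest minors are in bijection with the edges of $\Gamma_{(k,n)}$ incident to the vertex $\mathcal{J}$, and the number of such minors is at most $n$.
   Context: Notation: $[n]=\{1,\dots,n\}$ and $\binom{[n]}{k}$ is the set of $k$-element subsets of $[n]$. For a real $k\times n$ matrix $A$ of rank $k$ and $I\in\binom{[n]}{k}$, $\Delta_I(A)$ is the determinant of the $k\times k$ submatrix with column set $I$ (in increasing order). The positive Grassmannian $Gr^+(k,n)$ is the set of points of the real Grassmannian $Gr(k,n)$ (matrices modulo row operations) represented by matrices $A$ with $\Delta_I(A)>0$ for all $I$; equalities and inequalities between the $\Delta_I$ are taken for such representatives (they are defined up to a common positive factor). Arrangements: An arrangement of minors with $\mathcal{U}_0=\emptyset$ is an ordered set partition $\mathcal{U}=(\mathcal{U}_0,\mathcal{U}_1,\dots,\mathcal{U}_l)$ of $\binom{[n]}{k}$ with $\mathcal{U}_0=\emptyset$ and $\mathcal{U}_1,\dots,\mathcal{U}_l$ nonempty, for which there is a point of $Gr^+(k,n)$ with $\Delta_I=\Delta_J$ whenever $I,J$ lie in the same $\mathcal{U}_i$,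 and $\Delta_I<\Delta_J$ whenever $I\in\mathcal{U}_i$, $J\in\mathcal{U}_j$ with $i<j$. A set $\mathcal{J}\subset\binom{[n]}{k}$ is an arrangement of largest minors if there is such an arrangement $\mathcal{U}$ with $\mathcal{U}_l=\mathcal{J}$. For $t\ge2$, $\mathcal{Y}$ is a $(t,\mathcal{J})$-largest arrangement if there is such a $\mathcal{U}$ with $\mathcal{U}_l=\mathcal{J}$ and $\mathcal{U}_{l-t+1}=\mathcal{Y}$ (with $l-t+1\ge1$); $W$ is a $(t,\mathcal{J})$-largest minor if $W$ belongs to some $(t,\mathcal{J})$-largest arrangement. Sortedness: For $I,J\in\binom{[n]}{k}$ let $a_1\le a_2\le\dots\le a_{2k}$ be the non-decreasing rearrangement of the multiset union of $I$ and $J$; put $Sort_1(I,J)=\{a_1,a_3,\dots,a_{2k-1}\}$ and $Sort_2(I,J)=\{a_2,a_4,\dots,a_{2k}\}$. The pair $I,J$ is sorted if $\{I,J\}=\{Sort_1(I,J),Sort_2(I,J)\}$. A collection of $k$-subsets is sorted if every two of its elements are sorted. It is known that all inclusion-maximal sorted collections have exactly $n$ elements, and that arrangements of largest minors are exactly the nonempty sorted collections. Dual graph: The simplices with vertex sets $\{\epsilon_I: I\in\mathcal{I}\}$ ($\epsilon_I\in\{0,1\}^n$ the indicator vector of $I$), over all sorted collections $\mathcal{I}$, triangulate the hypersimplex $\{x\in[0,1]^n:\sum x_i=k\}$ (Sturmfels' triangulation). $\Gamma_{(k,n)}$ is the dual graph of this triangulation: its vertices are the maximal simplices, identified with the maximal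 sorted collections, and two are adjacent iff the simplices share a common facet, i.e. the two collections have exactly $n-1$ elements in common. *)

(* Defs.v *)
From HB Require Import structures.
From mathcomp Require Import all_boot all_order all_algebra.
From mathcomp Require Import boolp reals.

Set Implicit Arguments.
Unset Strict Implicit.
Unset Printing Implicit Defensive.

Import Order.TTheory GRing.Theory Num.Theory.

Local Open Scope ring_scope.

(* The k-subsets of [n]; the ground set {1, ..., n} is represented by 'I_n. *)
Notation ksubset k n := {I : {set 'I_n} | #|I| == k}.

Section PositiveGrassmannian.
Variables (R : realType) (k n : nat).
Implicit Types (A : 'M[R]_(k, n)) (I : ksubset k n).

(* enum lists the elements of a set of ordinals in increasing order. *)
Definition ksubset_elt I (i : 'I_k) : 'I_n :=
  enum_val (cast_ord (esym (eqP (valP I))) i).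

Definition minor A I : R := \det (colsub (ksubset_elt I) A).

(* A represents a point of Gr^+(k, n).  All conditions imposed on minors below
   are invariant under a common positive factor, so that quantifying over
   such A amounts to quantifying over the points of Gr^+(k, n). *)
Definition Gr_pos A : Prop := \rank A = k /\ forall I, 0 < minor A I.

End PositiveGrassmannian.

Section Arrangements.
Variables (R : realType) (k n : nat).
Implicit Types (U : seq {set ksubset k n}) (J Y : {set ksubset k n}).

(* The ordered partition (U_0, U_1, ..., U_l) with U_0 empty is encoded by the
   sequence of the l blocks U_1, ..., U_l; U_i is empty for i > l. *)
Definition block U (i : nat) : {set ksubset k n} := nth set0 (set0 :: U) i.

Definition ordered_partition U : bool :=
  uniq U && partition [set B in U] [set: ksubset k n].

Definition arrangement U : Prop :=
  ordered_partition U /\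
  exists A : 'M[R]_(k, n),
    [/\ Gr_pos A,
        (forall (i : nat) (I I' : ksubset k n),
           I \in block U i -> I' \in block U i -> minor A I = minor A I')
      & (forall (i j : nat) (I I' : ksubset k n), (i < j)%N ->
           I \in block U i -> I' \in block U j -> minor A I < minor A I')].

Definition largest_arrangement J : Prop :=
  exists U, arrangement U /\ block U (size U) = J.

Definition maximal_largest_arrangement J : Prop :=
  largest_arrangement J /\
  forall J', largest_arrangement J' -> J \subset J' -> J' = J.

Definition t_largest_arrangement (t : nat) J Y : Prop :=
  exists U, [/\ arrangement U, (t <= size U)%N, block U (size U) = J
              & block U (size U - t).+1 = Y].

Definition t_largest_minor (t : nat) J (W : ksubset k n) : Prop :=
  exists2 Y, t_largest_arrangement t J Y & W \in Y.

Definition t_largest_minors (t : nat) J : {set ksubset k n} :=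
  [set W | `[< t_largest_minor t J W >]].

End Arrangements.

Section Sortedness.
Variables (k n : nat).
Implicit Types (I J : ksubset k n) (C Q : {set ksubset k n}).

Definition merged I J : seq 'I_n :=
  sort (fun a b : 'I_n => (a <= b)%N) (enum (val I) ++ enum (val J)).

(* onth is indexed from 0: a_1, a_3, ... sit at the even positions. *)
Definition Sort1 I J : {set 'I_n} :=
  [set x | [exists i : 'I_k, onth (merged I J) i.*2 == Some x]].

Definition Sort2 I J : {set 'I_n} :=
  [set x | [exists i : 'I_k, onth (merged I J) i.*2.+1 == Some x]].

Definition sorted_pair I J : bool :=
  [set val I; val J] == [set Sort1 I J; Sort2 I J].

Definition sorted_collection C : bool :=
  [forall I in C, forall J in C, sorted_pair I J].

(* The graph Gamma_(k, n): a maximal simplex of the triangulation is given by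
   its vertex set, a maximal sorted collection, and two distinct ones share a
   facet when they have n - 1 vertices in common. *)
Definition Gamma_vertices : {set {set ksubset k n}} :=
  [set Q | maxset sorted_collection Q].

Definition Gamma_adj Q Q' : bool :=
  [&& Q \in Gamma_vertices, Q' \in Gamma_vertices, Q != Q'
    & #|Q :&: Q'| == n.-1].

Definition Gamma_edges : {set {set {set ksubset k n}}} :=
  [set [set p.1; p.2] | p : {set ksubset k n} * {set ksubset k n}
                          & Gamma_adj p.1 p.2].

Definition incident_edges Q : {set {set {set ksubset k n}}} :=
  [set e in Gamma_edges | Q \in e].

End Sortedness.

(* Main.v *)
Require Import Defs.
From HB Require Import structures.
From mathcomp Require Import all_boot all_order all_fingroup all_algebra.
From mathcomp Require Import boolp reals.
From mathcomp Require Import zify ring lra.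

Set Implicit Arguments.
Unset Strict Implicit.
Unset Printing Implicit Defensive.

Import Order.TTheory GRing.Theory Num.Theory.

Local Open Scope ring_scope.

(* A k-subset I of [n] is encoded by the functions g on Z/n whose cyclic slopes,
   corrected by k at the wrap-around, form the indicator function of I; such a
   lift is unique up to an additive constant.  Lifts are closed under pointwise
   minimum and maximum, and a collection is sorted exactly when its lifts form a
   chain.  A maximal chain increases by one unit vector at a time, and each
   coordinate is used once per period, whence the n elements.

   The three-term Plücker relations say that the minors of a point of Gr^+ are
   strictly log-supermodular on the unit squares of this lattice, hence on all
   incomparable pairs, so the largest minors form a sorted collection.
   Conversely, rescaling the columns makes the minors constant on a maximal chain
   T, and supermodularity then forces all other minors to be smaller.

   A lift w outside T straddles T somewhere: there are consecutive elements
   g, g + e_i, g + e_i + e_j of T with w <= g at i and w > g at j.  Clamping w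
   between g and g + e_i + e_j yields the flip g + e_j, the new vertex of an
   adjacent simplex, and does not decrease the minor.  So the second largest
   minors are flips.  For the converse, the minor of a flip relative to the
   largest one is a cross-ratio, which for a Vandermonde matrix is that of its
   nodes; bringing two pairs of neighbouring nodes together makes the prescribed
   flip the largest. *)

(** * Minors and the three-term Plücker relation *)

Section Minors.
Variables (R : realType) (k n : nat).
Implicit Types (A B : 'M[R]_(k, n)) (I : ksubset k n) (f : 'I_k -> 'I_n).

Lemma ksubset_elt_inj I : injective (ksubset_elt I).
Proof. by move=> i j /enum_val_inj /cast_ord_inj. Qed.

Lemma mem_ksubset_elt I i : ksubset_elt I i \in val I.
Proof. exact: enum_valP. Qed.

Lemma ksubset_elt_lt I (i j : 'I_k) :
  (i < j)%N -> (ksubset_elt I i < ksubset_elt I j)%N.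
Proof.
move=> ij; rewrite /ksubset_elt; set i' := cast_ord _ i; set j' := cast_ord _ j.
have ij' : (i' < j')%N by [].
have hs : sorted (fun a b : 'I_n => (a < b)%N) (enum (val I)).
  rewrite /enum_mem; apply: sorted_filter; first by move=> a b c; apply: ltn_trans.
  have := iota_ltn_sorted 0 n; rewrite -val_enum_ord sorted_map.
  by rewrite /enum_mem filter_predT.
rewrite (enum_val_nth (ksubset_elt I i) i') (enum_val_nth (ksubset_elt I i) j').
apply: (sorted_ltn_nth _ _ hs); rewrite ?inE -?cardE ?ltn_ord //.
by move=> a b c; apply: ltn_trans.
Qed.

Lemma ksubset_elt_perm I f : injective f -> (forall i, f i \in val I) ->
  exists s : 'S_k, forall i, f i = ksubset_elt I (s i).
Proof.
move=> finj fI.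
have surj x : x \in val I -> exists j, x = ksubset_elt I j.
  move=> xI; exists (cast_ord (eqP (valP I)) (enum_rank_in xI x)).
  by rewrite /ksubset_elt cast_ord_comp cast_ord_id enum_rankK_in.
have [s0 hs0] := choice (fun i => surj _ (fI i)).
have s0inj : injective s0.
  by move=> i j e; apply: finj; rewrite !hs0 e.
by exists (perm s0inj) => i; rewrite permE.
Qed.

(** The sign [b] is that of the permutation sorting [f], hence the same for every matrix; this is
    what allows signs to be compared between two matrices. *)
Lemma det_colsub_perm I f : injective f -> (forall i, f i \in val I) ->
  exists b : bool, forall A, \det (colsub f A) = (-1) ^+ b * minor A I.
Proof.
move=> finj fI; have [s hs] := ksubset_elt_perm finj fI.
exists (s : bool) => A; rewrite /minor.
have -> : colsub f A = col_perm s (colsub (ksubset_elt I) A).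
  by apply/matrixP=> i j; rewrite !mxE hs.
by rewrite col_permE det_mulmx det_perm odd_permV mulrC.
Qed.

Lemma minor_abs_det A I f : Gr_pos A -> injective f -> (forall i, f i \in val I) ->
  minor A I = `|\det (colsub f A)|.
Proof.
move=> [_ Apos] finj fI; have [b ->] := det_colsub_perm finj fI.
by rewrite normrM normr_sign mul1r gtr0_norm.
Qed.

Lemma det_colsub_same_sign A B I f : Gr_pos A -> Gr_pos B ->
  injective f -> (forall i, f i \in val I) ->
  0 < \det (colsub f A) * \det (colsub f B).
Proof.
move=> [_ Apos] [_ Bpos] finj fI; have [b hb] := det_colsub_perm finj fI.
rewrite !hb mulrACA -signr_addb addbb mul1r; exact: mulr_gt0.
Qed.

Lemma Gr_pos_minors A : (k <= n)%N -> (forall I, 0 < minor A I) -> Gr_pos A.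
Proof.
move=> kn Apos; split=> //; apply/eqP; rewrite eqn_leq rank_leq_row /=.
have hS : #|[set i : 'I_n | (i < k)%N]| == k.
  have -> : [set i : 'I_n | (i < k)%N] = [set widen_ord kn i | i : 'I_k].
    apply/setP=> x; rewrite inE; apply/idP/imsetP => [xk|[i _ ->] /=].
      by exists (Ordinal xk) => //; apply: val_inj.
    exact: ltn_ord.
  by rewrite card_imset ?card_ord // => i j /(congr1 val) /= /val_inj.
pose I : ksubset k n := exist (fun S : {set _} => #|S| == k) _ hS.
have : minor A I != 0 by rewrite gt_eqF.
rewrite /minor -unitfE -[_ \is a _]/(_ \in unitmx) -row_full_unit => /eqP.
(* The invertible submatrix is a product with left factor [A], so its rank [k] bounds the rank of
   [A] from below. *)
rewrite -[X in colsub _ X]mulmx1 -mulmx_colsub => e.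
have := mxrankM_maxl A (colsub (ksubset_elt I) 1%:M); rewrite e; exact: id.
Qed.

Definition vandermonde (u : 'I_n -> R) : 'M[R]_(k, n) := \matrix_(i, j) u j ^+ i.

Lemma det_colsub_vandermonde u f :
  \det (colsub f (vandermonde u)) =
  \prod_(i < k) \prod_(j < k | (i < j)%N) (u (f j) - u (f i)).
Proof.
have -> : colsub f (vandermonde u) = Vandermonde k (\row_j u (f j)).
  by apply/matrixP=> i j; rewrite !mxE.
rewrite det_Vandermonde; apply: eq_bigr => i _; apply: eq_bigr => j _.
by rewrite !mxE.
Qed.

Lemma Gr_pos_vandermonde u : (k <= n)%N ->
  (forall x y : 'I_n, (x < y)%N -> u x < u y) -> Gr_pos (vandermonde u).
Proof.
move=> kn hu; apply: Gr_pos_minors => // I.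
rewrite /minor det_colsub_vandermonde; apply: prodr_gt0 => i _.
by apply: prodr_gt0 => j ij; rewrite subr_gt0 hu // ksubset_elt_lt.
Qed.

End Minors.

(** * Determinants with two varying columns and the others fixed *)

Section TwoColumns.
Variables (R : realType) (k n : nat) (c : 'I_k -> 'I_n).
Implicit Types (A B : 'M[R]_(k.+2, n)) (x y z w : 'I_n).

(** The varying columns come first, regardless of their position in [[n]], so a bracket is a minor
    only up to sign. *)
Definition with_columns x y : 'I_(2 + k) -> 'I_n := fun i =>
  match split i with inl a => if a == 0 then x else y | inr b => c b end.

Lemma with_columns_inj x y : injective c -> x != y ->
  (forall b, c b != x) -> (forall b, c b != y) -> injective (with_columns x y).
Proof.
move=> cinj xy cx cy i j; rewrite /with_columns.
move=> e; rewrite -(splitK i) -(splitK j); move: e.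
case: (split i) => [a|b]; case: (split j) => [a'|b'].
- move: a a' => [[|[|//]] ?] [[|[|//]] ?] /= e; do ?[by congr (lshift _ _); apply: val_inj].
    by case/eqP: xy.
  by case/eqP: xy.
- by case: ifP => _ e; [case/eqP: (cx b')|case/eqP: (cy b')].
- by case: ifP => _ e; [case/eqP: (cx b)|case/eqP: (cy b)].
by move=> /cinj ->.
Qed.

Lemma with_columns_mem x y (S : {set 'I_n}) : x \in S -> y \in S ->
  (forall b, c b \in S) -> forall i, with_columns x y i \in S.
Proof. by move=> xS yS cS i; rewrite /with_columns; case: split => [a|b] //; case: ifP. Qed.

Definition bracket A x y : R := \det (colsub (with_columns x y) A).

(* After multiplication by an inverse of the columns x0, y0, c, the columns c become the last unit vectors. *)
Lemma bracket_form A : exists (d : R) (a b : 'I_n -> R),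
  forall x y, bracket A x y = d * (a x * b y - a y * b x).
Proof.
case: (pselect (exists x0 y0, bracket A x0 y0 != 0)) => [[x0 [y0 d0]]|no]; last first.
  exists 0, (fun=> 0), (fun=> 0) => x y; rewrite mul0r; apply/eqP/negPn/negP => h.
  by apply: no; exists x, y.
pose M : 'M[R]_(2 + k) := colsub (with_columns x0 y0) A.
have uM : M \in unitmx by rewrite unitmxE unitfE.
pose A' : 'M[R]_(2 + k, n) := invmx M *m A.
exists (bracket A x0 y0), (A' (lshift k 0)), (A' (lshift k 1)) => x y.
have cM i b : A' i (c b) = (i == rshift 2 b)%:R.
  have := mulVmx uM => /matrixP /(_ i (rshift 2 b)); rewrite /M mulmx_colsub !mxE.
  by rewrite /with_columns (unsplitK (inr b)).
rewrite /bracket.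
have -> : colsub (with_columns x y) A = M *m colsub (with_columns x y) A'.
  by rewrite mulmx_colsub /A' mulmxA mulmxV // mul1mx.
rewrite det_mulmx; congr (_ * _); clearbody A'.
have wl z t (b : 'I_2) : with_columns z t (lshift k b) = if b == 0 then z else t.
  by rewrite /with_columns (unsplitK (inl b)).
have wr z t b : with_columns z t (rshift 2 b) = c b.
  by rewrite /with_columns (unsplitK (inr b)).
(* The matrix is block lower triangular with an identity block at the lower right, so only the 2 x 2
   block in columns [x] and [y] contributes. *)
rewrite -[X in \det X]submxK.
have -> : ursubmx (colsub (with_columns x y) A') = 0.
  by apply/matrixP=> i j; rewrite [LHS]mxE mxE [LHS]mxE wr cM eq_lrshift mxE.
have -> : drsubmx (colsub (with_columns x y) A') = 1%:M.
  by apply/matrixP=> i j; rewrite [LHS]mxE mxE [LHS]mxE wr cM eq_rshift mxE.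
rewrite (@det_lblock R 2 k).
rewrite det1 mulr1 (expand_det_row _ 0) !big_ord_recl big_ord0 /cofactor.
rewrite !det_mx11 addr0.
rewrite !mxE.
rewrite !wl /=; have -> : lift 0 0 = 1 :> 'I_2 by apply: val_inj.
by rewrite /bump /= !expr0 ?expr1; ring.
Qed.

(** By [bracket_form] all brackets are 2 x 2 determinants up to one common factor, which leaves a
    polynomial identity. *)
Lemma bracket_plucker A x y z w :
  bracket A x y * bracket A z w =
  bracket A x w * bracket A z y + bracket A x z * bracket A y w.
Proof. by have [d [a [b h]]] := bracket_form A; rewrite !h; ring. Qed.

(** The Vandermonde product splits into the pair [x], [y], the pairs joining [x] or [y] to a fixed
    column ([G]), and the pairs of fixed columns ([P]). Both [G] and [P] drop out of
    cross-ratios. *)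
Lemma bracket_vandermonde (u : 'I_n -> R) : exists (G : 'I_n -> R) (P : R),
  forall x y, bracket (vandermonde k.+2 u) x y = (u y - u x) * G x * G y * P.
Proof.
exists (fun x => \prod_b (u (c b) - u x)).
exists (\prod_(a < k) \prod_(b < k | (a < b)%N) (u (c b) - u (c a))) => x y.
have wl z t (b : 'I_2) : with_columns z t (lshift k b) = if b == 0 then z else t.
  by rewrite /with_columns (unsplitK (inl b)).
have wr z t b : with_columns z t (rshift 2 b) = c b.
  by rewrite /with_columns (unsplitK (inr b)).
rewrite /bracket det_colsub_vandermonde (@big_split_ord _ _ _ 2 k) /=; congr (_ * _).
  rewrite !big_ord_recl big_ord0 mulr1.
  rewrite !(@big_split_ord _ _ _ 2 k) /= !wl /=.
  rewrite [X in X * _ * _]big_mkcond [X in _ * (X * _)]big_mkcond.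
  rewrite !big_ord_recl !big_ord0 /= !wl /= /bump /= !mul1r !mulr1.
  by congr (_ * _ * _); apply: eq_bigr => b _; rewrite wr.
apply: eq_bigr => a _; rewrite (@big_split_ord _ _ _ 2 k) /= wr.
rewrite big1 ?mul1r; last by move=> b; have := ltn_ord b; lia.
by apply: eq_big => b; rewrite ?wr // ltn_add2l.
Qed.

End TwoColumns.

Section Exchange.
Variables (R : realType).

Lemma ksubset_of_inj k n (f : 'I_k -> 'I_n) : injective f ->
  exists I : ksubset k n, forall i, f i \in val I.
Proof.
move=> finj; have h : #|[set f i | i : 'I_k]| == k by rewrite card_imset // card_ord.
by exists (exist (fun S : {set _} => #|S| == k) _ h) => i; apply: imset_f.
Qed.

(** The numbers [a], [b], [e] have the signs of [al * K], [be * K], [ga * K]. As [be] and [ga] both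
    have the sign of [al], the summands [b] and [e] have equal signs and absolute values add. *)
Lemma signed_sum (a b e al be ga K : R) : a = b + e ->
  0 < al * be -> 0 < al * ga -> 0 < a * (al * K) -> 0 < b * (be * K) ->
  0 < e * (ga * K) -> 0 < `|e| /\ `|a| = `|b| + `|e|.
Proof.
move=> -> h1 h2 ha hb he.
have K0 : K != 0 by apply: contraTneq ha => ->; rewrite !mulr0 ltxx.
have K2 : 0 < K ^+ 2 by rewrite exprn_even_gt0.
have be2 : 0 < (be * K) ^+ 2.
  by rewrite exprn_even_gt0 //=; apply: contraTneq hb => ->; rewrite mulr0 ltxx.
have e0 : e != 0 by apply: contraTneq he => ->; rewrite mul0r ltxx.
have bega : 0 < be * ga.
  have : 0 < (al * be) * (al * ga) by apply: mulr_gt0.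
  rewrite mulrACA -expr2; have [->|al0] := eqVneq al 0; first by rewrite expr0n mul0r ltxx.
  by rewrite pmulr_rgt0 // exprn_even_gt0.
have hbe : 0 < b * e.
  have := mulr_gt0 hb he; rewrite [ltRHS](_ : _ = (b * e) * ((be * ga) * K ^+ 2)); last by ring.
  by rewrite pmulr_lgt0 // mulr_gt0.
split; first by rewrite normr_gt0.
have [b0|b0|b0] := ltrgt0P b; last by move: hbe; rewrite b0 mul0r ltxx.
  by move: hbe; rewrite pmulr_rgt0 // => ?; rewrite !gtr0_norm ?addr_gt0.
by move: hbe; rewrite nmulr_rgt0 // => ?; rewrite !ltr0_norm ?opprD //; lra.
Qed.

(* The brackets of a point of the positive Grassmannian have the same signs as those of a Vandermonde matrix, where they are given by differences. *)
Lemma bracket_exchange k n (c : 'I_k -> 'I_n) (A : 'M[R]_(k.+2, n)) x y z w :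
  (k.+2 <= n)%N -> Gr_pos A -> injective c ->
  uniq [:: x; y; z; w] -> (forall b, c b \notin [:: x; y; z; w]) ->
  let d (s t : 'I_n) : R := t%:R - s%:R in
  0 < d x y * d z w * (d x w * d z y) ->
  0 < d x y * d z w * (d x z * d y w) ->
  0 < `|bracket c A x z * bracket c A y w| /\
  `|bracket c A x y * bracket c A z w| =
    `|bracket c A x w * bracket c A z y| + `|bracket c A x z * bracket c A y w|.
Proof.
move=> kn hA cinj hu hc d h1 h2.
pose u (s : 'I_n) : R := s%:R.
have hV : Gr_pos (vandermonde k.+2 u).
  by apply: Gr_pos_vandermonde => // s t; rewrite /u ltr_nat.
have [G [P hG]] := bracket_vandermonde c u.
have sgn s t : s \in [:: x; y; z; w] -> t \in [:: x; y; z; w] -> s != t ->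
    0 < bracket c A s t * (d s t * G s * G t * P).
  move=> hs ht st; rewrite -[d s t]/(u t - u s) -hG.
  have finj : injective (with_columns c s t).
    apply: with_columns_inj => // b; first by apply: contraNneq (hc b) => ->.
    by apply: contraNneq (hc b) => ->.
  have [I hI] := ksubset_of_inj finj.
  exact: (det_colsub_same_sign hA hV finj hI).
move: hu; rewrite /= !inE !negb_or => /and4P[/and3P[xy xz xw] /andP[yz yw] zw _].
(* Each of the three products of brackets involves all of [x], [y], [z], [w] once, so the factors
   [G] and [P] enter all of them identically and only the differences [d] decide the relative
   signs. *)
have key s t p q : s \in [:: x; y; z; w] -> t \in [:: x; y; z; w] -> s != t ->
    p \in [:: x; y; z; w] -> q \in [:: x; y; z; w] -> p != q ->
    0 < (bracket c A s t * bracket c A p q) *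
        ((d s t * d p q) * (G s * G t * G p * G q * P ^+ 2)).
  move=> hs ht st hp hq pq; have := mulr_gt0 (sgn s t hs ht st) (sgn p q hp hq pq).
  by congr (0 < _); ring.
apply: (signed_sum (K := G x * G y * G z * G w * P ^+ 2) (bracket_plucker c A x y z w) h1 h2).
- by apply: key; rewrite // !inE eqxx ?orbT.
- rewrite (_ : G x * G y * G z * G w = G x * G w * G z * G y); last by ring.
  by apply: key; rewrite ?inE ?eqxx ?orbT // eq_sym.
rewrite (_ : G x * G y * G z * G w = G x * G z * G y * G w); last by ring.
by apply: key; rewrite ?inE ?eqxx ?orbT // eq_sym.
Qed.

Lemma card_add2 (n k : nat) (C : {set 'I_n}) (I : ksubset k n) x y :
  x \notin C -> y \notin C -> x != y -> val I = x |: (y |: C) -> k = #|C|.+2.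
Proof.
move=> xC yC xy e; have := eqP (valP I); rewrite e cardsU1 cardsU1 !inE.
by rewrite (negPf xy) (negPf xC) (negPf yC) => <-.
Qed.

(** Brackets need a number of rows of the form [_.+2], whereas [k] only satisfies an equation.
    Hiding the bracket behind an existential confines the rewriting of [k] to this proof. *)
Lemma exists_bracket k n (C : {set 'I_n}) : k = #|C|.+2 -> (k <= n)%N ->
  exists B : 'M[R]_(k, n) -> 'I_n -> 'I_n -> R,
  [/\ forall A (I : ksubset k n) s t, Gr_pos A -> s \notin C -> t \notin C -> s != t ->
        val I = s |: (t |: C) -> minor A I = `|B A s t|,
      forall A x y z w, Gr_pos A -> uniq [:: x; y; z; w] ->
        all (fun s => s \notin C) [:: x; y; z; w] ->
        let d (s t : 'I_n) : R := t%:R - s%:R in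
        0 < d x y * d z w * (d x w * d z y) ->
        0 < d x y * d z w * (d x z * d y w) ->
        0 < `|B A x z * B A y w| /\
        `|B A x y * B A z w| = `|B A x w * B A z y| + `|B A x z * B A y w|
    & forall u, exists (G : 'I_n -> R) (P : R),
        forall s t, B (vandermonde k u) s t = (u t - u s) * G s * G t * P].
Proof.
move=> -> kn; pose c (b : 'I_#|C|) : 'I_n := enum_val b.
have cinj : injective c by apply: enum_val_inj.
have cC b : c b \in C by apply: enum_valP.
exists (fun A => bracket c A); split.
- move=> A I s t hA sC tC st eI; apply: minor_abs_det => //.
    by apply: with_columns_inj => // b; [apply: contraNneq sC|apply: contraNneq tC] => <-.
  by apply: with_columns_mem => [||b]; rewrite eI !inE ?eqxx ?orbT // cC !orbT.
- move=> A x y z w hA hu /allP hC; apply: bracket_exchange => // b.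
  by apply: contraTN (cC b) => /hC.
by move=> u; apply: bracket_vandermonde.
Qed.

Section Sets.
Variables (k n : nat) (C : {set 'I_n}) (x y z w : 'I_n).
Variables (I1 I2 I3 I4 : ksubset k n).
Hypotheses (kn : (k <= n)%N) (xyzw : uniq [:: x; y; z; w]).
Hypothesis (xyzwC : all (fun s => s \notin C) [:: x; y; z; w]).
Hypotheses (e1 : val I1 = x |: (y |: C)) (e2 : val I2 = z |: (w |: C)).
Hypotheses (e3 : val I3 = x |: (w |: C)) (e4 : val I4 = z |: (y |: C)).

Let distinct : [/\ x != y, z != w, x != w & z != y] /\
  [/\ x \notin C, y \notin C, z \notin C & w \notin C].
Proof.
move: xyzw xyzwC; rewrite /= !inE !negb_or.
by move=> /and4P[/and3P[? ? ?] /andP[? ?] ? _] /and5P[*]; do 2!split=> //; rewrite eq_sym.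
Qed.

(** The inequality is strict because the third term of the Plücker relation is nonzero. *)
Lemma minor_exchange (A : 'M[R]_(k, n)) : Gr_pos A ->
  let d (s t : 'I_n) : R := t%:R - s%:R in
  0 < d x y * d z w * (d x w * d z y) ->
  0 < d x y * d z w * (d x z * d y w) ->
  minor A I3 * minor A I4 < minor A I1 * minor A I2.
Proof.
move=> hA d h1 h2; have [[xy zw xw zy] [xC yC zC wC]] := distinct.
have [B [hB hE _]] := exists_bracket (card_add2 xC yC xy e1) kn.
have [e0 e] := hE A x y z w hA xyzw xyzwC h1 h2.
rewrite (hB A I1 x y) // (hB A I2 z w) // (hB A I3 x w) // (hB A I4 z y) //.
by rewrite -!normrM e ltrDl.
Qed.

(** The factors [G] and [P] agree on both sides; what is left is the cross-ratio of the four nodes,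
    written without division. *)
Lemma minor_vandermonde_ratio (u : 'I_n -> R) : Gr_pos (vandermonde k u) ->
  minor (vandermonde k u) I3 * minor (vandermonde k u) I4 *
    `|(u y - u x) * (u w - u z)| =
  minor (vandermonde k u) I1 * minor (vandermonde k u) I2 *
    `|(u w - u x) * (u y - u z)|.
Proof.
move=> hA; have [[xy zw xw zy] [xC yC zC wC]] := distinct.
have [B [hB _ hV]] := exists_bracket (card_add2 xC yC xy e1) kn.
have [G [P hG]] := hV u.
rewrite (hB _ I1 x y) // (hB _ I2 z w) // (hB _ I3 x w) // (hB _ I4 z y) //.
by rewrite -!normrM !hG; congr `|_|; ring.
Qed.

End Sets.
End Exchange.

(** * Arrangements as level sets of minors *)

Section LevelSets.
Variables (R : realType) (k n : nat).
Implicit Types (A : 'M[R]_(k, n)) (I W : ksubset k n) (U : seq {set ksubset k n}).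

Definition argmax_minors A : {set ksubset k n} :=
  [set I | [forall I', minor A I' <= minor A I]].

Lemma argmax_minorsP A I :
  reflect (forall I', minor A I' <= minor A I) (I \in argmax_minors A).
Proof. by rewrite inE; apply: forallP. Qed.

Definition minor_values A : seq R :=
  sort <=%R (undup (codom (minor A))).

Lemma sorted_minor_values A : sorted <%R (minor_values A).
Proof.
rewrite lt_sorted_uniq_le sort_uniq undup_uniq /=.
by apply: sort_sorted => x y; apply: le_total.
Qed.

Lemma mem_minor_values A I : minor A I \in minor_values A.
Proof. by rewrite mem_sort mem_undup; apply: codom_f. Qed.

Definition level_sets A : seq {set ksubset k n} :=
  [seq [set I | minor A I == v] | v <- minor_values A].

(** Block 0 is the empty set prepended by [block], whence the shift by one between a block and the
    position of its value. *)
Lemma mem_block_level_sets A i I :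
  (I \in block (level_sets A) i) = (0 < i)%N && (i == (index (minor A I) (minor_values A)).+1).
Proof.
rewrite /block; case: i => [|i] /=; first by rewrite in_set0.
have us : uniq (minor_values A) by rewrite sort_uniq undup_uniq.
case: (ltnP i (size (minor_values A))) => hi.
  rewrite (nth_map 0) // inE eqSS; apply/eqP/eqP => [->|->].
    by rewrite index_uniq.
  by rewrite nth_index // mem_minor_values.
rewrite nth_default ?size_map // in_set0; symmetry; apply/negbTE.
by rewrite eqSS neq_ltn orbC (leq_trans _ hi) // index_mem mem_minor_values.
Qed.

Lemma index_minor_values_lt A I I' :
  (index (minor A I) (minor_values A) < index (minor A I') (minor_values A))%N =
  (minor A I < minor A I').
Proof.
have ss := sorted_minor_values A.
rewrite -(lt_sorted_ltn_nth 0 ss) ?inE ?index_mem ?mem_minor_values //.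
by rewrite !nth_index ?mem_minor_values.
Qed.

Lemma level_sets_arrangement A : Gr_pos A -> arrangement R (level_sets A).
Proof.
move=> hA; have us : uniq (minor_values A) by rewrite sort_uniq undup_uniq.
have ex v : v \in minor_values A -> exists I, minor A I = v.
  by rewrite mem_sort mem_undup => /codomP[I ->]; exists I.
split; last exists A.
  apply/andP; split.
    rewrite map_inj_in_uniq // => v v' /ex[I <-] /ex[I' <-] /setP /(_ I).
    by rewrite !inE eqxx => /esym /eqP.
  apply/and3P; split.
  - apply/eqP/setP=> I; rewrite inE; apply/bigcupP.
    exists [set I' | minor A I' == minor A I]; last by rewrite inE.
    by rewrite inE; apply: map_f; apply: mem_minor_values.
  - apply/trivIsetP => B B'; rewrite !inE => /mapP[v _ ->] /mapP[v' _ ->] ne.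
    apply/pred0P=> I; rewrite !inE /=; apply/negbTE/negP => /andP[/eqP e /eqP e'].
    by case/eqP: ne; rewrite -e -e'.
  rewrite inE; apply/mapP => -[v /ex[I e] /setP /(_ I)].
  by rewrite !inE e eqxx.
split=> // [i I I'|i j I I' ij].
  rewrite !mem_block_level_sets => /andP[_ /eqP ->] /andP[_]; rewrite eqSS => /eqP e.
  have := congr1 (nth 0 (minor_values A)) e.
  by rewrite !nth_index ?mem_minor_values.
rewrite !mem_block_level_sets => /andP[_ /eqP e] /andP[_ /eqP e'].
by rewrite -index_minor_values_lt; lia.
Qed.

Lemma block_last_level_sets A : (0 < size (level_sets A))%N ->
  block (level_sets A) (size (level_sets A)) = argmax_minors A.
Proof.
rewrite size_map => s0; apply/setP=> I; rewrite mem_block_level_sets s0 /=.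
apply/eqP/argmax_minorsP => [e I'|h].
  rewrite leNgt -index_minor_values_lt -leqNgt.
  by rewrite -ltnS -e index_mem mem_minor_values.
apply/eqP; rewrite eqn_leq index_mem mem_minor_values andbT.
have hs : ((size (minor_values A)).-1 < size (minor_values A))%N by rewrite ltn_predL.
have := mem_nth 0 hs; set v := nth _ _ _ => hv.
have : v \in undup (codom (minor A)) by rewrite -(mem_sort <=%R).
rewrite mem_undup => /codomP[I' ev].
have : ~~ (minor A I < minor A I') by rewrite -leNgt.
rewrite -index_minor_values_lt -ev index_uniq ?sort_uniq ?undup_uniq //.
by rewrite -leqNgt -ltnS prednK.
Qed.

Section Arrangement.
Variables (U : seq {set ksubset k n}) (A : 'M[R]_(k, n)).
Hypotheses (hU : ordered_partition U)
  (hlt : forall (i j : nat) I I', (i < j)%N ->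
     I \in block U i -> I' \in block U j -> minor A I < minor A I')
  (heq : forall (i : nat) I I',
     I \in block U i -> I' \in block U i -> minor A I = minor A I').

Lemma exists_block I : exists i, [/\ (0 < i)%N, (i <= size U)%N & I \in block U i].
Proof.
have /andP[_ /and3P[/eqP hc _ _]] := hU.
have : I \in [set: ksubset k n] by rewrite inE.
rewrite -hc => /bigcupP[B]; rewrite inE => BU IB.
exists (index B U).+1; split=> //; first by rewrite index_mem.
by rewrite /block /= nth_index.
Qed.

Lemma block_inhabited i : (0 < i)%N -> (i <= size U)%N -> exists I, I \in block U i.
Proof.
case: i => // i _ hi; have /andP[_ /and3P[_ _ h0]] := hU.
apply/set0Pn; apply: contraNneq h0 => e; rewrite inE -e /block /=; exact: mem_nth.
Qed.

Lemma block_last : (0 < size U)%N -> block U (size U) = argmax_minors A.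
Proof.
move=> s0; apply/setP=> I; apply/idP/argmax_minorsP => [hI I'|h].
  have [i [i0 iU hi]] := exists_block I'.
  case: (eqVneq i (size U)) => [e|ne]; first by rewrite e in hi; rewrite (heq hi hI).
  by apply/ltW/(hlt _ hi hI); lia.
have [i [i0 iU hi]] := exists_block I; have [I' hI'] := block_inhabited s0 (leqnn _).
case: (eqVneq i (size U)) => [<- //|ne].
have : minor A I < minor A I' by apply: (hlt _ hi hI'); lia.
by rewrite ltNge h.
Qed.

Lemma block_second W : (1 < size U)%N -> W \in block U (size U).-1 ->
  W \notin argmax_minors A /\
  forall I, I \notin argmax_minors A -> minor A I <= minor A W.
Proof.
move=> s1 hW; have s0 : (0 < size U)%N by lia.
rewrite -block_last //; split.
  have lt_s : ((size U).-1 < size U)%N by lia.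
  by apply/negP => /(hlt lt_s hW); rewrite ltxx.
move=> I nI; have [i [i0 iU hi]] := exists_block I.
have iN : i != size U by apply: contraNneq nI => <-.
case: (eqVneq i (size U).-1) => [e|ne]; first by rewrite e in hi; rewrite (heq hi hW).
by apply/ltW/(hlt _ hi hW); lia.
Qed.

End Arrangement.

Lemma exists_ksubset : (k <= n)%N -> exists I : ksubset k n, true.
Proof.
move=> kn; have inj : injective (widen_ord kn).
  by move=> i j /(congr1 val) /= /val_inj.
by have [I _] := ksubset_of_inj inj; exists I.
Qed.

(** Every positive matrix yields an arrangement through the level sets of its minors, so
    arrangements can be traded for matrices. The bound [k <= n] provides a subset, so that there is
    a last block. *)
Lemma largest_arrangementP (J : {set ksubset k n}) : (k <= n)%N ->
  largest_arrangement R J <-> exists A, Gr_pos A /\ argmax_minors A = J.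
Proof.
move=> kn; have [I0 _] := exists_ksubset kn.
split=> [[U [[hU [A [hA heq hlt]]] <-]]|[A [hA <-]]].
  exists A; split=> //; symmetry; apply: block_last => //.
  by have [i [i0 iU _]] := exists_block hU I0; apply: leq_trans iU.
exists (level_sets A); split; first exact: level_sets_arrangement.
apply: block_last_level_sets; rewrite size_map.
by apply: leq_trans (_ : (index (minor A I0) (minor_values A)).+1 <= _)%N; rewrite ?index_mem ?mem_minor_values.
Qed.

Lemma argmax_minors_inhabited A : (k <= n)%N -> exists I, I \in argmax_minors A.
Proof.
move=> kn; have [I0 _] := exists_ksubset kn.
exists [arg max_(I > I0) minor A I]%O; apply/argmax_minorsP => I.
by case: arg_maxP => // I' _ /(_ I isT).
Qed.

Lemma second_largest_minorP (J : {set ksubset k n}) W : (k <= n)%N ->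
  t_largest_minor R 2 J W <-> exists A,
    [/\ Gr_pos A, argmax_minors A = J, W \notin J
      & forall I, I \notin J -> minor A I <= minor A W].
Proof.
move=> kn; split=> [[Y [U [[hU [A [hA heq hlt]]] s2 <- <-]]]|[A [hA <- nW hW]]].
  rewrite (_ : (size U - 2).+1 = (size U).-1); last by lia.
  move=> hW; exists A; rewrite !(block_last hU hlt heq) //; last by lia.
  by have [] := block_second hU hlt heq s2 hW.
have [I0 hI0] := argmax_minors_inhabited A kn.
have s0 : (0 < size (level_sets A))%N.
  rewrite size_map.
  by apply: leq_trans (_ : (index (minor A I0) (minor_values A)).+1 <= _)%N; rewrite ?index_mem ?mem_minor_values.
have last I : (I \in argmax_minors A) = (size (level_sets A) == (index (minor A I) (minor_values A)).+1).
  by rewrite -block_last_level_sets // mem_block_level_sets s0.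
have ltW : minor A W < minor A I0.
  rewrite lt_neqAle (argmax_minorsP _ _ hI0) andbT; apply: contraNneq nW => e.
  by apply/argmax_minorsP => I; rewrite e; move: I; apply/argmax_minorsP.
move: ltW; rewrite -index_minor_values_lt => ltW.
have eI0 := last I0; rewrite hI0 in eI0; move/esym/eqP: eI0 => eI0.
have s2 : (1 < size (level_sets A))%N by rewrite eI0 ltnS; apply: leq_ltn_trans ltW.
exists (block (level_sets A) (size (level_sets A) - 2).+1).
  exists (level_sets A); split=> //; first exact: level_sets_arrangement.
  exact: block_last_level_sets.
rewrite mem_block_level_sets /= eqSS eI0 subSS subn1 eqn_leq.
apply/andP; split; last by rewrite -ltnS prednK // (leq_ltn_trans _ ltW).
(* [p] is the position just before the largest value. A subset attaining the value at [p] is not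
   maximal, so the minor of [W] is at least that value. *)
set p := (index (minor A I0) _).-1.
have hp : (p < size (minor_values A))%N.
  by rewrite /p (leq_ltn_trans (leq_pred _)) // index_mem mem_minor_values.
have := mem_nth 0 hp; set v := nth _ _ _ => hv.
have : v \in undup (codom (minor A)) by rewrite -(mem_sort <=%R).
rewrite mem_undup => /codomP[I' ev].
have ip : index (minor A I') (minor_values A) = p.
  by rewrite -ev index_uniq ?sort_uniq ?undup_uniq.
have nI' : I' \notin argmax_minors A.
  by rewrite last eI0 eqSS ip gtn_eqF // /p ltn_predL (leq_ltn_trans _ ltW).
have : ~~ (minor A W < minor A I') by rewrite -leNgt hW.
by rewrite -index_minor_values_lt ip -leqNgt.
Qed.

End LevelSets.

(** * Lifts of subsets to integer functions *)

Section Lattice.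
Variables (k n : nat).
Implicit Types (g h p q w : 'I_n -> int) (x y i j : 'I_n) (c : int).

(** [g] is one period of a function on the integers with [g (x + n) = g x + k], and the slope is its
    forward difference; the correction is felt at the last index only. *)
Definition slope g x : int := g (ordS x) - g x + (if x.+1 == n then k%:Z else 0).

Definition is_lift g := forall x, 0 <= slope g x <= 1.

Definition supp g : {set 'I_n} := [set x | slope g x == 1].

Definition shift g c : 'I_n -> int := fun x => g x + c.
Definition step g i : 'I_n -> int := fun x => g x + (x == i)%:R.
Definition le_fun g h := forall x, g x <= h x.
Definition meet g h : 'I_n -> int := fun x => Num.min (g x) (h x).
Definition join g h : 'I_n -> int := fun x => Num.max (g x) (h x).
Definition total g : int := \sum_x g x.

Definition comparable_fun g h := le_fun g h \/ le_fun h g.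

Lemma slope_shift g c x : slope (shift g c) x = slope g x.
Proof. rewrite /slope /shift; lia. Qed.

Lemma is_lift_shift g c : is_lift g -> is_lift (shift g c).
Proof. by move=> hg x; rewrite slope_shift. Qed.

Lemma supp_shift g c : supp (shift g c) = supp g.
Proof. by apply/setP=> x; rewrite !inE slope_shift. Qed.

Lemma is_lift_meet g h : is_lift g -> is_lift h -> is_lift (meet g h).
Proof.
move=> hg hh x; move: (hg x) (hh x); rewrite /slope /meet; case: ifP => _; lia.
Qed.

Lemma is_lift_join g h : is_lift g -> is_lift h -> is_lift (join g h).
Proof.
move=> hg hh x; move: (hg x) (hh x); rewrite /slope /join; case: ifP => _; lia.
Qed.

Lemma sum_slope g : (0 < n)%N -> \sum_x slope g x = k%:Z.
Proof.
move=> n0; rewrite /slope big_split /= sumrB.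
rewrite -(reindex_inj (@ordS_inj n) (P := xpredT) (F := g)) subrr add0r.
rewrite -big_mkcond /=.
have lt : (n.-1 < n)%N by rewrite ltn_predL.
rewrite (bigD1 (Ordinal lt)) /=; last by rewrite prednK.
rewrite big1 ?addr0 // => i /andP[/eqP i1 /eqP] []; apply: val_inj => /=; lia.
Qed.

Lemma card_supp g : (0 < n)%N -> is_lift g -> #|supp g| = k.
Proof.
move=> n0 hg; have := sum_slope g n0.
rewrite (bigID (mem (supp g))) /= [X in _ + X]big1 ?addr0; last first.
  by move=> x; rewrite inE; move: (hg x); lia.
rewrite (eq_bigr (fun=> 1)); last by move=> x; rewrite inE => /eqP.
by rewrite sumr_const natz => -[<-].
Qed.

Lemma le_fun_trans g h p : le_fun g h -> le_fun h p -> le_fun g p.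
Proof. by move=> gh hp x; apply: le_trans (gh x) (hp x). Qed.

Lemma le_fun_refl g : le_fun g g.
Proof. by move=> x. Qed.

Lemma le_fun_anti g h : le_fun g h -> le_fun h g -> g = h.
Proof. by move=> gh hg; apply/funext=> x; apply/eqP; rewrite eq_le gh hg. Qed.

Lemma not_le_fun g h : ~ le_fun g h -> exists x, h x < g x.
Proof. by move/existsNP=> [x /negP]; rewrite -ltNge; exists x. Qed.

Lemma le_total_fun g h : le_fun g h -> total g <= total h.
Proof. by move=> gh; apply: ler_sum. Qed.

Lemma lt_total_fun g h : le_fun g h -> g <> h -> total g < total h.
Proof.
move=> gh ne; rewrite lt_neqAle le_total_fun // andbT; apply/negP => /eqP e.
case: ne; apply/funext => x.
have /eqP := e; rewrite -subr_eq0 -sumrB /= -oppr_eq0 -sumrN psumr_eq0.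
  by move=> /allP /(_ x (mem_index_enum _)) /=; lia.
by move=> y _; move: (gh y); lia.
Qed.

Lemma total_step g i : total (step g i) = total g + 1.
Proof.
rewrite /total /step big_split /=; congr (_ + _).
rewrite (bigD1 i) //= eqxx big1 ?addr0 // => x /negPf -> //.
Qed.

Lemma total_shift g c : total (shift g c) = total g + n%:Z * c.
Proof.
by rewrite /total /shift big_split /= sumr_const card_ord -mulr_natl natz.
Qed.

Lemma step_self g i : step g i i = g i + 1.
Proof. by rewrite /step eqxx. Qed.

Lemma le_step g i : le_fun g (step g i).
Proof. move=> x; rewrite /step; lia. Qed.

Lemma shift_step g i c : shift (step g i) c = step (shift g c) i.
Proof. apply/funext=> x; rewrite /shift /step; lia. Qed.

Lemma stepC g i j : step (step g i) j = step (step g j) i.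
Proof. apply/funext=> x; rewrite /step; lia. Qed.

(* Where h - g is maximal, tie-broken by the smallest value of the periodic function g - k x / n, raising g by one keeps its slopes in {0, 1}. *)
Lemma exists_step g h : (0 < k < n)%N -> is_lift g -> is_lift h ->
  le_fun g h -> g <> h -> exists i, is_lift (step g i) /\ le_fun (step g i) h.
Proof.
move=> /andP[k0 kn] hg hh gh ne.
have n0 : (0 < n)%N by apply: leq_trans kn.
pose x0 : 'I_n := Ordinal n0.
pose M := [arg max_(x > x0) (h x - g x)]%O.
have hM x : h x - g x <= h M - g M.
  by rewrite /M; case: arg_maxP => // i _ /(_ x isT).
pose Q x := h x - g x == h M - g M.
pose i := [arg min_(x < M | Q x) (n%:Z * g x - k%:Z * x%:Z)]%O.
have [Qi hi] : Q i /\ forall x, Q x ->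
    n%:Z * g i - k%:Z * i%:Z <= n%:Z * g x - k%:Z * x%:Z.
  by rewrite /i; case: arg_minP => [|y Qy hy]; rewrite /Q ?eqxx.
have [x hx] : exists x, g x < h x.
  by apply: not_le_fun => hg'; apply: ne; apply: le_fun_anti.
have hgi : g i + 1 <= h i.
  by move: Qi (hM x); rewrite /Q; lia.
exists i; split; last first.
  by move=> y; rewrite /step; case: eqVneq => [->|_]; [exact: hgi | rewrite addr0].
(* With slope 0 at [i], the maximum of [h - g] would also be attained at [ordS i], where the
   tie-breaking value is smaller by [k]. *)
have si : slope g i = 1.
  have := hg i; have := hM (ordS i); have := hi (ordS i).
  have := hh i; rewrite /slope /Q.
  move: Qi; rewrite /Q => /eqP <-.
  have -> : (ordS i : nat) = if i.+1 == n then 0%N else i.+1.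
    rewrite /=; case: eqVneq => [->|ne']; first by rewrite modnn.
    by rewrite modn_small //; have := ltn_ord i; lia.
  case: (eqVneq (h (ordS i) - g (ordS i)) (h i - g i)) => [e|ne'].
    case: (eqVneq i.+1 n) => [e2 _ /(_ isT)|e2 _ /(_ isT)]; nia.
  by case: ifP => _; lia.
pose j := ord_pred i; have ji : ordS j = i by rewrite ord_predK.
(* With slope 1 at [j], the maximum of [h - g] would also be attained at [j], where the tie-breaking
   value is smaller by [n - k]. *)
have sj : slope g j = 0.
  have := hg j; have := hM j; have := hi j.
  have := hh j; rewrite /slope /Q ji.
  move: Qi; rewrite /Q => /eqP <-.
  have -> : (i : nat) = if j.+1 == n then 0%N else j.+1.
    rewrite -{1}ji /=; case: eqVneq => [->|ne']; first by rewrite modnn.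
    by rewrite modn_small //; have := ltn_ord j; lia.
  case: (eqVneq (h j - g j) (h i - g i)) => [e|ne'].
    case: (eqVneq j.+1 n) => [e2 _ /(_ isT)|e2 _ /(_ isT)]; nia.
  by case: ifP => _; lia.
have nj : j != i by apply/eqP=> e; move: sj; rewrite e si.
move=> y; rewrite /slope /step.
case: (eqVneq y i) => [->|yi].
  have /negPf -> : ordS i != i by rewrite -{2}ji (inj_eq (@ordS_inj n)) eq_sym.
  by move: si; rewrite /slope; lia.
case: (eqVneq y j) => [->|yj]; first by rewrite ji eqxx; move: sj; rewrite /slope ji; lia.
have /negPf -> : ordS y != i by rewrite -ji (inj_eq (@ordS_inj n)).
by move: (hg y); rewrite /slope; lia.
Qed.

(** A step at [i] lowers the slope at [i] by one and raises the preceding slope by one, which forces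
    their values. On subsets it moves the element [i] to its cyclic predecessor. *)
Lemma slope_step g i : (1 < n)%N -> is_lift g -> is_lift (step g i) ->
  [/\ slope g i = 1, slope g (ord_pred i) = 0
    & supp (step g i) = ord_pred i |: (supp g :\ i)].
Proof.
move=> n1 hg hgi.
have nS y : ordS y != y.
  apply/eqP => /(congr1 val) /=; case: (eqVneq y.+1 n) => [e|ne].
    by rewrite e modnn; lia.
  by rewrite modn_small; have := ltn_ord y; lia.
pose j := ord_pred i; have ji : ordS j = i by rewrite ord_predK.
have nj : j != i by rewrite -ji eq_sym.
have e1 : slope (step g i) i = slope g i - 1.
  by rewrite /slope /step eqxx (negPf (nS i)); lia.
have e2 : slope (step g i) j = slope g j + 1.
  by rewrite /slope /step ji eqxx (negPf nj); lia.
have := hg i; have := hgi i; have := hg j; have := hgi j; rewrite e1 e2 => a1 a2 a3 a4.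
split; [lia|rewrite -/j; lia|apply/setP => y; rewrite !inE -/j].
case: (eqVneq y j) => [->|yj]; first by rewrite e2; lia.
case: (eqVneq y i) => [->|yi]; first by rewrite e1; lia.
rewrite /slope /step (negPf yi).
have /negPf -> : ordS y != i by rewrite -ji (inj_eq (@ordS_inj n)).
by rewrite !addr0.
Qed.

Lemma step_square g i j : i != j -> is_lift (step g i) -> is_lift (step g j) ->
  is_lift (step (step g i) j).
Proof.
move=> ij hi hj; have -> : step (step g i) j = join (step g i) (step g j).
  apply/funext=> x; rewrite /step /join.
  by case: (eqVneq x i) => [->|]; rewrite ?(negPf ij); lia.
exact: is_lift_join.
Qed.

Lemma lift_determined g h : is_lift g -> is_lift h -> supp g = supp h ->
  exists c, h = shift g c.
Proof.
move=> hg hh e.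
case: (posnP n) => [n0|n0].
  by exists 0; apply/funext => x; by move: (ltn_ord x); move: (x : nat) => m; rewrite n0.
pose x0 : 'I_n := Ordinal n0.
have es x : slope g x = slope h x.
  by move/setP: e => /(_ x); rewrite !inE; move: (hg x) (hh x); lia.
exists (h x0 - g x0); apply/funext => x; rewrite /shift.
suff H m (hm : (m < n)%N) : h (Ordinal hm) = g (Ordinal hm) + (h x0 - g x0).
  by case: x => m hm; apply: H.
elim: m hm => [|m IH] hm.
  by rewrite (_ : Ordinal hm = x0); [lia|exact: val_inj].
have hm' : (m < n)%N by apply: ltnW.
have e' : ordS (Ordinal hm') = Ordinal hm.
  by apply: val_inj; rewrite /= modn_small.
have := es (Ordinal hm'); rewrite /slope e'; have := IH hm'; lia.
Qed.

End Lattice.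

(** * Sortedness as comparability of lifts *)

Section Counting.
Variable n : nat.
Implicit Types (S : {set 'I_n}) (x : 'I_n) (s : seq 'I_n).

Definition card_below S (m : nat) : nat := #|[set y in S | (y < m)%N]|.

Lemma card_below0 S : card_below S 0 = 0%N.
Proof. by apply/eqP; rewrite cards_eq0; apply/eqP/setP=> y; rewrite !inE andbF. Qed.

Lemma card_below_all S : card_below S n = #|S|.
Proof. by apply: eq_card => y; rewrite !inE ltn_ord andbT. Qed.

Lemma card_belowS S x : card_below S x.+1 = (card_below S x + (x \in S))%N.
Proof.
rewrite /card_below; case: (boolP (x \in S)) => xS.
  rewrite (_ : [set y in S | _] = x |: [set y in S | (y < x)%N]).
    by rewrite cardsU1 !inE ltnn andbF addnC.
  apply/setP=> y; rewrite !inE ltnS leq_eqVlt.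
  by case: (eqVneq y x) => [->|ne]; rewrite ?eqxx ?xS // (inj_eq val_inj) (negPf ne).
rewrite addn0; apply: eq_card => y; rewrite !inE ltnS leq_eqVlt (inj_eq val_inj).
by case: (eqVneq y x) => [->|]; rewrite ?(negPf xS).
Qed.

Lemma eq_card_below S (f : nat -> nat) : f 0%N = 0%N ->
  (forall x, f x.+1 = (f x + (x \in S))%N) ->
  forall m, (m <= n)%N -> card_below S m = f m.
Proof.
move=> f0 fS; elim=> [|m IH] hm; first by rewrite card_below0 f0.
by have := fS (Ordinal hm); have := card_belowS S (Ordinal hm); rewrite /= => -> ->; rewrite IH // ltnW.
Qed.

Lemma count_enum_set S m : count (fun y : 'I_n => (y < m)%N) (enum S) = card_below S m.
Proof.
rewrite -size_filter /card_below cardE; apply/perm_size/uniq_perm.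
- by rewrite filter_uniq ?enum_uniq.
- exact: enum_uniq.
by move=> y; rewrite mem_filter !mem_enum !inE andbC.
Qed.

(** Equal entries of a sorted list fill a contiguous run of positions, so an entry can be located by
    counting; repetitions are allowed, as needed for merged lists. *)
Lemma onth_sorted s x p : sorted (fun a b : 'I_n => (a <= b)%N) s ->
  (onth s p == Some x) =
  (count (fun y : 'I_n => (y < x)%N) s <= p < count (fun y : 'I_n => (y < x.+1)%N) s)%N.
Proof.
elim: s p => [|a s IH] p /= hs; first by case: p.
have ps := path_sorted hs.
have tr : transitive (fun a b : 'I_n => (a <= b)%N).
  by move=> b c d; apply: leq_trans.
have /allP ha := order_path_min tr hs.
have z m : (m <= a)%N -> count (fun y : 'I_n => (y < m)%N) s = 0%N.
  move=> ma; apply/eqP; rewrite eqn0Ngt -has_count; apply/hasPn => y /ha ay.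
  by rewrite -leqNgt (leq_trans ma ay).
have zx := z x; have zx1 := z x.+1.
case: p => [|p] /=.
  rewrite (inj_eq Some_inj) -(inj_eq val_inj) /=; lia.
rewrite IH //; lia.
Qed.

End Counting.

Section Sorting.
Variables k n : nat.
Implicit Types I J : ksubset k n.

Lemma card_ksubset I : #|val I| = k.
Proof. exact/eqP/(valP I). Qed.

Lemma count_merged I J m :
  count (fun y : 'I_n => (y < m)%N) (merged I J) =
  (card_below (val I) m + card_below (val J) m)%N.
Proof.
by rewrite /merged (seq.permP (permEl (perm_sort _ _))) count_cat !count_enum_set.
Qed.

Lemma onth_merged I J x p : (onth (merged I J) p == Some x) =
  (card_below (val I) x + card_below (val J) x <= p
    < card_below (val I) x.+1 + card_below (val J) x.+1)%N.
Proof.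
by rewrite onth_sorted ?count_merged //; apply: sort_sorted => a b; apply: leq_total.
Qed.

Lemma card_below_le I m : (card_below (val I) m <= k)%N.
Proof.
apply: leq_trans (eq_leq (card_ksubset I)).
by apply: subset_leq_card; apply/subsetP=> y; rewrite !inE => /andP[].
Qed.

(** Among the first [c] merged entries, [uphalf c] sit at the even positions counted from 0;
    likewise [c./2] at the odd positions for [Sort2]. *)
Lemma card_below_Sort1 I J m : (m <= n)%N ->
  card_below (Sort1 I J) m = uphalf (card_below (val I) m + card_below (val J) m).
Proof.
move: m; apply: (@eq_card_below _ _
  (fun m => uphalf (card_below (val I) m + card_below (val J) m))).
  by rewrite !card_below0.
move=> x; rewrite inE.
have -> : [exists i : 'I_k, onth (merged I J) i.*2 == Some x] =
  (uphalf (card_below (val I) x + card_below (val J) x) <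
   uphalf (card_below (val I) x.+1 + card_below (val J) x.+1))%N.
  apply/existsP/idP => [[i]|h]; first by rewrite onth_merged; lia.
  have := card_below_le I x.+1; have := card_below_le J x.+1 => h1 h2.
  have hi : (uphalf (card_below (val I) x + card_below (val J) x) < k)%N by lia.
  have ei : (Ordinal hi : nat) = (uphalf (card_below (val I) x + card_below (val J) x))%N by [].
  by exists (Ordinal hi); rewrite onth_merged ei; lia.
rewrite !card_belowS; lia.
Qed.

Lemma card_below_Sort2 I J m : (m <= n)%N ->
  card_below (Sort2 I J) m = ((card_below (val I) m + card_below (val J) m)./2)%N.
Proof.
move: m; apply: (@eq_card_below _ _
  (fun m => (card_below (val I) m + card_below (val J) m)./2)).
  by rewrite !card_below0.
move=> x; rewrite inE.
have -> : [exists i : 'I_k, onth (merged I J) i.*2.+1 == Some x] =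
  ((card_below (val I) x + card_below (val J) x)./2 <
   (card_below (val I) x.+1 + card_below (val J) x.+1)./2)%N.
  apply/existsP/idP => [[i]|h]; first by rewrite onth_merged; lia.
  have := card_below_le I x.+1; have := card_below_le J x.+1 => h1 h2.
  have hi : ((card_below (val I) x + card_below (val J) x)./2 < k)%N by lia.
  have ei : (Ordinal hi : nat) = ((card_below (val I) x + card_below (val J) x)./2)%N by [].
  by exists (Ordinal hi); rewrite onth_merged ei; lia.
rewrite !card_belowS; lia.
Qed.

Lemma card_below_inj (S S' : {set 'I_n}) :
  (forall m, (m <= n)%N -> card_below S m = card_below S' m) -> S = S'.
Proof.
move=> h; apply/setP=> x; have := h x.+1 (ltn_ord x); have := h x (ltnW (ltn_ord x)).
rewrite !card_belowS => ->; lia.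
Qed.

(** In terms of the increasing elements this says [i_1 <= j_1 <= i_2 <= j_2 <= ...]. *)
Definition interleaved I J := forall m, (m <= n)%N ->
  (card_below (val J) m <= card_below (val I) m <= (card_below (val J) m).+1)%N.

Lemma sorted_pairP I J :
  sorted_pair I J <-> interleaved I J \/ interleaved J I.
Proof.
split=> [/eqP e|h].
  have : val I = Sort1 I J /\ val J = Sort2 I J \/
         val I = Sort2 I J /\ val J = Sort1 I J.
    have /set2P hI : val I \in [set Sort1 I J; Sort2 I J] by rewrite -e set21.
    have /set2P hJ : val J \in [set Sort1 I J; Sort2 I J] by rewrite -e set22.
    have /set2P h1 : Sort1 I J \in [set val I; val J] by rewrite e set21.
    have /set2P h2 : Sort2 I J \in [set val I; val J] by rewrite e set22.
    by case: hI hJ h1 h2 => eI [] eJ [] e1 [] e2; (left; split; congruence) || (right; split; congruence).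
  case=> -[eI eJ]; [left|right] => m hm.
    by rewrite eI eJ card_below_Sort1 // card_below_Sort2 //; lia.
  by rewrite eI eJ card_below_Sort1 // card_below_Sort2 //; lia.
apply/eqP; case: h => h.
  congr [set _; _]; apply: card_below_inj => m hm; have := h m hm.
    by rewrite card_below_Sort1 //; lia.
  by rewrite card_below_Sort2 //; lia.
rewrite [RHS]setUC; congr [set _; _]; apply: card_below_inj => m hm; have := h m hm.
  by rewrite card_below_Sort2 //; lia.
by rewrite card_below_Sort1 //; lia.
Qed.

Definition lift_of I : 'I_n -> int := fun x => (card_below (val I) x)%:Z.

Lemma slope_lift_of I x : slope k (lift_of I) x = (x \in val I)%:R.
Proof.
rewrite /slope /lift_of.
have := card_belowS (val I) x; rewrite [ordS x : nat]/=.
case: eqVneq => [e|ne].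
  rewrite e modnn card_below0 card_below_all card_ksubset; lia.
rewrite modn_small; first lia.
by have := ltn_ord x; lia.
Qed.

Lemma is_lift_of I : is_lift k (lift_of I).
Proof. by move=> x; rewrite slope_lift_of; case: (x \in _). Qed.

Lemma supp_lift_of I : supp k (lift_of I) = val I.
Proof. by apply/setP=> x; rewrite inE slope_lift_of; case: (x \in _). Qed.

(** All lifts of [I] and [J] are shifts of their counting functions. All shifts are comparable
    exactly when the difference of the counting functions takes at most two values, which are
    consecutive; as it vanishes at 0, this is interleaving in one order or the other. *)
Lemma sorted_pair_comparable I J : (0 < n)%N ->
  sorted_pair I J <->
  forall g h, is_lift k g -> is_lift k h -> supp k g = val I -> supp k h = val J ->
    comparable_fun g h.
Proof.
move=> n0; pose x0 : 'I_n := Ordinal n0.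
rewrite sorted_pairP; split=> [H g h hg hh eg eh|H].
  have [c ->] : exists c, g = shift (lift_of I) c.
    by apply: (lift_determined (is_lift_of I) hg); rewrite supp_lift_of.
  have [d ->] : exists d, h = shift (lift_of J) d.
    by apply: (lift_determined (is_lift_of J) hh); rewrite supp_lift_of.
  rewrite /comparable_fun /le_fun /shift /lift_of.
  case: H => H.
    case: (lerP d c) => dc; [right|left] => x; have := H x (ltnW (ltn_ord x)); lia.
  case: (lerP c d) => dc; [left|right] => x; have := H x (ltnW (ltn_ord x)); lia.
(* The case [lift_of B + 1 <= lift_of A] is impossible, since both counting functions vanish at
   index 0. The bound at [m = n] lies outside the domain of the lifts and follows from equal
   cardinalities. *)
have key A B : le_fun (lift_of B) (lift_of A) ->
    comparable_fun (lift_of A) (shift (lift_of B) 1) -> interleaved A B.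
  move=> BA [AB m|/(_ x0)]; last by rewrite /shift /lift_of /= !card_below0.
  rewrite leq_eqVlt => /orP[/eqP ->|hm].
    by rewrite !card_below_all !card_ksubset leqnn leqnSn.
  by have := BA (Ordinal hm); have := AB (Ordinal hm); rewrite /shift /lift_of /=; lia.
have Hs c d : comparable_fun (shift (lift_of I) c) (shift (lift_of J) d).
  by apply: H; rewrite ?supp_shift ?supp_lift_of //; apply/is_lift_shift/is_lift_of.
have s0 (g : 'I_n -> int) : shift g 0 = g by apply/funext=> x; rewrite /shift addr0.
have := Hs 0 0; rewrite !s0 => -[h|h]; [right|left]; apply: key => //.
  by have := Hs 1 0; rewrite !s0 => -[]; [right|left].
by have := Hs 0 1; rewrite s0.
Qed.

End Sorting.

(** * Maximal chains of lifts *)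

Section Chains.
Variables (k n : nat).
Implicit Types (g h p q w : 'I_n -> int) (x y i j : 'I_n) (c : int).
Implicit Type T : ('I_n -> int) -> Prop.

Record maximal_chain T : Prop := MaximalChain {
  chain_lift : forall g, T g -> is_lift k g;
  chain_shift : forall g c, T g -> T (shift g c);
  chain_comparable : forall g h, T g -> T h -> comparable_fun g h;
  chain_maximal : forall w, is_lift k w ->
    (forall g, T g -> comparable_fun w g) -> T w;
  chain_inhabited : exists g, T g }.

Lemma between_step g h i : le_fun g h -> le_fun h (step g i) ->
  h = g \/ h = step g i.
Proof.
move=> gh hs; case: (eqVneq (h i) (g i)) => [e|ne]; [left|right].
  apply/funext=> x; move: (gh x) (hs x); rewrite /step.
  by case: (eqVneq x i) => [->|_]; lia.
apply/funext=> x; move: (gh x) (hs x); rewrite /step.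
by case: (eqVneq x i) => [->|_]; lia.
Qed.

Lemma wall_neq w g i j : w i <= g i -> step g i j < w j -> i != j.
Proof. by move=> wi wj; apply/eqP=> ij; move: wi wj; rewrite -ij step_self; lia. Qed.

(** The two bounds differ only at [i] and [j]: at [i] the lower bound is taken because [w <= g], at
    [j] the upper one because [w > g]. *)
Lemma wall_clamp w g i j : w i <= g i -> step g i j < w j ->
  join (meet w (step (step g i) j)) g = step g j.
Proof.
move=> wi wj; have ij := wall_neq wi wj.
apply/funext=> x; move: wi wj; rewrite /join /meet /step.
case: (eqVneq x j) => [->|xj]; first by rewrite eq_sym (negPf ij); lia.
by case: (eqVneq x i) => [->|xi]; rewrite ?(negPf ij); lia.
Qed.

Lemma exists_shift_below g w : exists c, le_fun (shift g c) w.
Proof.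
exists (- \sum_y (`|g y| + `|w y|)) => x.
have : `|g x| + `|w x| <= \sum_y (`|g y| + `|w y|).
  by rewrite (bigD1 x) //= lerDl sumr_ge0 // => y _; rewrite addr_ge0.
rewrite /shift; lia.
Qed.

Lemma exists_shift_above g w : exists c, le_fun w (shift g c).
Proof.
exists (\sum_y (`|g y| + `|w y|)) => x.
have : `|g x| + `|w x| <= \sum_y (`|g y| + `|w y|).
  by rewrite (bigD1 x) //= lerDl sumr_ge0 // => y _; rewrite addr_ge0.
rewrite /shift; lia.
Qed.

(** Induction on the gap [total h - total g], which is nonnegative for ordered pairs. The property
    concerns both ends, so either may be moved. *)
Lemma total_ind (P : ('I_n -> int) -> ('I_n -> int) -> Prop) :
  (forall g h, (forall p q, total q - total p < total h - total g ->
     le_fun p q -> P p q) -> le_fun g h -> P g h) ->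
  forall g h, le_fun g h -> P g h.
Proof.
move=> H g h gh.
have [m hm] : exists m : nat, total h - total g <= m%:Z.
  by exists `|total h - total g|%N; lia.
elim: m g h gh hm => [|m IH] g h gh hm; apply: H => // p q hpq pq.
  by have := le_total_fun pq; lia.
by apply: IH => //; lia.
Qed.

Variable T : ('I_n -> int) -> Prop.
Hypotheses (kn : (0 < k < n)%N) (hT : maximal_chain T).

(** Take a step [i] from [g] that stays below [h]. If it leaves [T], maximality gives an element [p]
    of [T] incomparable to it; this [p] lies strictly between [g] and [h], and the induction
    continues on the shorter interval from [g] to [p]. *)
Lemma chain_step g h : T g -> T h -> le_fun g h -> g <> h ->
  exists i, T (step g i) /\ le_fun (step g i) h.
Proof.
move=> Tg Th gh; move: g h gh Tg Th.
apply: total_ind => g h IH gh Tg Th ne.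
have [i [li ih]] := exists_step kn (chain_lift hT Tg) (chain_lift hT Th) gh ne.
case: (pselect (T (step g i))) => [Ti|nTi]; first by exists i.
have [p [Tp np]] : exists p, T p /\ ~ comparable_fun (step g i) p.
  apply: contrapT => no; apply: nTi; apply: (chain_maximal hT li) => p Tp.
  by apply: contrapT => np; apply: no; exists p.
have gp : le_fun g p.
  case: (chain_comparable hT Tg Tp) => // pg.
  by case: np; right; apply: le_fun_trans pg (le_step _ _).
have gnp : g <> p by move=> e; apply: np; right; rewrite -e; apply: le_step.
have hnp : ~ le_fun h p by move=> hp; apply: np; left; apply: le_fun_trans hp.
have ph : le_fun p h by case: (chain_comparable hT Th Tp).
have lt_ph : total p < total h.
  by apply: lt_total_fun => // e; apply: hnp; rewrite e; apply: le_fun_refl.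
have lt_gp : total p - total g < total h - total g by lia.
have [i' [Ti' hi']] := IH g p lt_gp gp Tg Tp gnp.
by exists i'; split=> //; apply: le_fun_trans ph.
Qed.

Lemma chain_step_unique g i j : T (step g i) -> T (step g j) -> i = j.
Proof.
move=> Ti Tj; case: (chain_comparable hT Ti Tj) => [/(_ i)|/(_ j)];
  by rewrite /step eqxx; case: eqVneq => //; lia.
Qed.

(** Shift [g] to agree with [h] at [i]. Of two elements of [T] agreeing at [i], the larger cannot
    lie above the step at [i] of the smaller one, so it lies between that element and its step, and
    they coincide. *)
Lemma chain_step_shift g h i :
  T g -> T (step g i) -> T h -> T (step h i) -> exists c, h = shift g c.
Proof.
have key p q : T p -> T (step p i) -> T q -> le_fun p q -> q i = p i -> q = p.
  move=> Tp Tpi Tq pq e; case: (chain_comparable hT Tpi Tq) => [/(_ i)|hq].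
    by rewrite step_self; lia.
  by case: (between_step pq hq) => // e'; move: e; rewrite e' step_self; lia.
move=> Tg Tgi Th Thi; exists (h i - g i).
have Ts := chain_shift hT (h i - g i) Tg.
have Tsi := chain_shift hT (h i - g i) Tgi; rewrite shift_step in Tsi.
have e : shift g (h i - g i) i = h i by rewrite /shift; lia.
case: (chain_comparable hT Ts Th) => le; first exact: key.
by symmetry; apply: key.
Qed.

Lemma chain_climb g h i : T g -> T h -> le_fun g h -> g i < h i ->
  exists p, T p /\ T (step p i).
Proof.
move=> Tg Th gh; move: g h gh Tg Th; apply: total_ind => g h IH gh Tg Th gi.
have ne : g <> h by move=> e; move: gi; rewrite e; lia.
have [j [Tj jh]] := chain_step Tg Th gh ne.
case: (eqVneq j i) => [e|ji]; first by exists g; rewrite -e.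
have [] // := IH (step g j) h.
- by rewrite total_step; lia.
- by rewrite /step eq_sym (negPf ji) addr0.
by move=> p hp; exists p.
Qed.

(** On its way from [g] to [g + 1] the chain must raise every coordinate. *)
Lemma chain_step_exists i : exists g, T g /\ T (step g i).
Proof.
have [g Tg] := chain_inhabited hT.
apply: (@chain_climb g (shift g 1)); rewrite /shift => //; last by lia.
  exact: chain_shift.
by move=> x /=; lia.
Qed.

(** After a shift the two elements agree at [i0], so the part of the chain joining them contains no
    step at [i0]. Invariance under the steps at the other [n - 1] coordinates is therefore
    enough. *)
Lemma chain_constant (V : Type) (phi : ('I_n -> int) -> V) (i0 : 'I_n) :
  (forall g c, phi (shift g c) = phi g) ->
  (forall g i, T g -> T (step g i) -> i != i0 -> phi (step g i) = phi g) ->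
  forall g h, T g -> T h -> phi g = phi h.
Proof.
move=> hshift hstep.
have key g h : le_fun g h -> T g -> T h -> g i0 = h i0 -> phi g = phi h.
  move: g h; apply: total_ind => g h IH gh Tg Th e.
  case: (pselect (g = h)) => [-> //|ne].
  have [j [Tj jh]] := chain_step Tg Th gh ne.
  have ji : j != i0.
    by apply/eqP=> ji; have := jh i0; rewrite ji step_self e; lia.
  rewrite -(hstep _ j) //; apply: IH => //; first by rewrite total_step; lia.
  by rewrite /step eq_sym (negPf ji) addr0.
move=> g h Tg Th; rewrite -(hshift h (g i0 - h i0)).
have Ts := chain_shift hT (g i0 - h i0) Th.
have e : g i0 = shift h (g i0 - h i0) i0 by rewrite /shift; lia.
by case: (chain_comparable hT Tg Ts) => le; [|symmetry]; apply: key.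
Qed.

(** Climb [T] from below [w] until the next step would leave the region below [w]; this happens
    before the top, since otherwise [w] would be an element of [T]. *)
Lemma chain_floor w : is_lift k w -> ~ T w ->
  exists g i, [/\ T g, T (step g i), le_fun g w & w i = g i].
Proof.
move=> lw nw; have [g0 Tg0] := chain_inhabited hT.
have [c hc] := exists_shift_below g0 w.
have [d hd] := exists_shift_above g0 w.
have Th := chain_shift hT d Tg0.
have := chain_shift hT c Tg0; move: (shift g0 c) (shift g0 d) hc hd Th.
move=> g h gw wh Th Tg; have gh := le_fun_trans gw wh.
move: g h gh gw wh Tg Th; apply: total_ind => g h IH gh gw wh Tg Th.
have ne : g <> h.
  by move=> e; apply: nw; rewrite (le_fun_anti wh) // -e.
have [i [Ti ih]] := chain_step Tg Th gh ne.
case: (eqVneq (w i) (g i)) => [e|ni]; first by exists g, i.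
apply: (IH (step g i) h) => //; first by rewrite total_step; lia.
by move=> x; move: (gw x); rewrite /step; case: (eqVneq x i) => [->|_]; lia.
Qed.

Lemma chain_ceil w g : T g -> exists h, [/\ T h, le_fun w h & le_fun g h].
Proof.
move=> Tg; have [d hd] := exists_shift_above g (join g w).
exists (shift g d); split; first exact: chain_shift.
  by move=> x; move: (hd x); rewrite /join; lia.
by move=> x; move: (hd x); rewrite /join; lia.
Qed.

(* Climbing T from below w, one meets a step i that stays above w at i immediately followed by a step j that stays below w at j; otherwise w would be in T. *)
Lemma chain_wall w : is_lift k w -> ~ T w ->
  exists g i j, [/\ T g, T (step g i), T (step (step g i) j), w i <= g i
    & step g i j < w j].
Proof.
move=> lw nw; have [g [i [Tg Ti gw wi]]] := chain_floor lw nw.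
have [x hx] : exists x, step g i x < w x.
  apply: not_le_fun => wg; case: (between_step gw wg) => e; apply: nw; rewrite e //.
have {gw} wi' : w i <= g i by lia.
have [h [Th wh gh]] := chain_ceil w Ti.
(* The climb is by induction on the current element [s], with its last step [i] recorded, together
   with a fixed coordinate [x] at which [s] is still below [w]. *)
suff H : forall s h, le_fun s h -> forall g i x, T g -> s = step g i -> T s ->
    w i <= g i -> T h -> le_fun w h -> s x < w x ->
    exists g i j, [/\ T g, T (step g i), T (step (step g i) j), w i <= g i
      & step g i j < w j] by apply: (H _ h gh g i x).
move=> {g h i x Tg Ti wi gh hx Th wh wi'}; apply: total_ind.
move=> s h IH sh g i x Tg es Ts wi Th wh hx.
have ne : s <> h by move=> e; move: (wh x) hx; rewrite -e es; lia.
have [j [Tj jh]] := chain_step Ts Th sh ne.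
case: (ltrP (s j) (w j)) => wj; first by exists g, i, j; rewrite -es.
have ht : total h - total (step s j) < total h - total s by rewrite total_step; lia.
apply: (IH (step s j) h ht jh s j x) => //.
rewrite {1}/step; case: (eqVneq x j) => [e|_]; last by rewrite addr0.
by move: hx wj; rewrite -e; lia.
Qed.

End Chains.

(** * Log-supermodular functions on lifts *)

Section Supermodular.
Variables (R : realFieldType) (k n : nat).
Implicit Types (g h p q w : 'I_n -> int) (x y i j : 'I_n) (c : int).
Implicit Type F : ('I_n -> int) -> R.

Definition strictly_log_supermodular F := forall p q, is_lift k p -> is_lift k q ->
  ~ comparable_fun p q -> F p * F q < F (meet p q) * F (join p q).

Definition locally_log_supermodular F := forall g i j, i != j ->
  is_lift k g -> is_lift k (step g i) -> is_lift k (step g j) ->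
  F (step g i) * F (step g j) < F g * F (step (step g i) j).

Lemma meet_funC p q : meet p q = meet q p.
Proof. by apply/funext=> x; rewrite /meet minC. Qed.

Lemma join_funC p q : join p q = join q p.
Proof. by apply/funext=> x; rewrite /join maxC. Qed.

Lemma comparable_funC p q : comparable_fun p q -> comparable_fun q p.
Proof. by case; [right|left]. Qed.

Lemma meet_fun_l p q : le_fun p q -> meet p q = p.
Proof. by move=> pq; apply/funext=> x; move: (pq x); rewrite /meet; lia. Qed.

Lemma join_fun_r p q : le_fun p q -> join p q = q.
Proof. by move=> pq; apply/funext=> x; move: (pq x); rewrite /join; lia. Qed.

(** If [p] is more than one step above the meet, let [r] be one step [i] above the meet and below
    [p]. The inequalities for the pairs [r], [q] and [p], [step q i], which have smaller defect,
    multiply to the desired one after cancelling [F r * F (step q i)]. If both [p] and [q] are one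
    step above the meet, this is a unit square. *)
Lemma local_global_supermodular F : (0 < k < n)%N ->
  (forall g, is_lift k g -> 0 < F g) ->
  locally_log_supermodular F -> strictly_log_supermodular F.
Proof.
move=> kn Fpos loc.
suff H (N : nat) p q : total p + total q - 2 * total (meet p q) <= N%:Z ->
    is_lift k p -> is_lift k q -> ~ comparable_fun p q ->
    F p * F q < F (meet p q) * F (join p q).
  by move=> p q; apply: (H `|(total p + total q - 2 * total (meet p q))%R|%N); lia.
elim: N p q => [|N IH] p q hN lp lq npq.
  case: npq; left; have mp : le_fun (meet p q) p by move=> x; rewrite /meet; lia.
  have mq : le_fun (meet p q) q by move=> x; rewrite /meet; lia.
  case: (pselect (meet p q = p)) => [<- //|ne].
  have := lt_total_fun mp ne; have := le_total_fun mq; lia.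
have lm := is_lift_meet lp lq.
have stepcase p' q' i : total p' + total q' - 2 * total (meet p' q') <= N.+1%:Z ->
    is_lift k p' -> is_lift k q' -> ~ comparable_fun p' q' ->
    is_lift k (step (meet p' q') i) -> le_fun (step (meet p' q') i) p' ->
    step (meet p' q') i <> p' -> F p' * F q' < F (meet p' q') * F (join p' q').
  move=> {}hN {}lp {}lq {}npq li ip ne.
  have qi : q' i < p' i.
    by have := ip i; rewrite /step /meet eqxx; lia.
  have e1 : meet (step (meet p' q') i) q' = meet p' q'.
    by apply/funext=> x; rewrite /meet /step; case: (eqVneq x i) => [->|_]; lia.
  have e2 : join (step (meet p' q') i) q' = step q' i.
    by apply/funext=> x; rewrite /meet /step /join; case: (eqVneq x i) => [->|_]; lia.
  have e3 : meet p' (step q' i) = step (meet p' q') i.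
    by apply/funext=> x; rewrite /meet /step; case: (eqVneq x i) => [->|_]; lia.
  have e4 : join p' (step q' i) = join p' q'.
    by apply/funext=> x; rewrite /step /join; case: (eqVneq x i) => [->|_]; lia.
  have lsq : is_lift k (step q' i) by rewrite -e2; apply: is_lift_join.
  have ltm := lt_total_fun ip ne; rewrite total_step in ltm.
  have a1 : F (step (meet p' q') i) * F q' < F (meet p' q') * F (step q' i).
    rewrite -[X in _ < F X * _]e1 -e2; apply: IH => //.
      by rewrite e1 total_step; lia.
    case=> [/(_ i)|qm].
      by rewrite step_self /meet; lia.
    by apply: npq; right; apply: le_fun_trans ip.
  have a2 : F p' * F (step q' i) < F (step (meet p' q') i) * F (join p' q').
    rewrite -[X in _ < F X * _]e3 -e4; apply: IH => //.
      by rewrite e3 !total_step; lia.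
    case=> [pq|qp]; last by apply: npq; right; apply: le_fun_trans (le_step _ _) qp.
    apply: ne; apply/funext=> x; move: (pq x) (ip x); rewrite /step /meet.
    by case: (eqVneq x i) => [->|_]; lia.
  have P1 := Fpos _ li; have P2 := Fpos _ lsq.
  have P3 := Fpos _ (is_lift_meet lp lq); have P4 := Fpos _ lq.
  have P5 := Fpos _ lp; have P6 := Fpos _ (is_lift_join lp lq).
  rewrite -(ltr_pM2r (mulr_gt0 P1 P2)).
  rewrite [ltLHS](_ : _ = (F (step (meet p' q') i) * F q') * (F p' * F (step q' i))); last by ring.
  rewrite [ltRHS](_ : _ = (F (meet p' q') * F (step q' i)) * (F (step (meet p' q') i) * F (join p' q'))); last by ring.
  by apply: ltr_pM => //; rewrite ltW // mulr_gt0.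
have mp : le_fun (meet p q) p by move=> x; rewrite /meet; lia.
have mq : le_fun (meet p q) q by move=> x; rewrite /meet; lia.
have nmp : meet p q <> p by move=> e; apply: npq; left; rewrite -e.
have nmq : meet p q <> q by move=> e; apply: npq; right; rewrite -e.
have [i [li ip]] := exists_step kn lm lp mp nmp.
have [j [lj jq]] := exists_step kn lm lq mq nmq.
case: (pselect (step (meet p q) i = p)) => [ei|]; last exact: stepcase.
case: (pselect (step (meet p q) j = q)) => [ej|ne]; last first.
  rewrite mulrC meet_funC join_funC; apply: (stepcase _ _ j); rewrite 1?[meet q p]meet_funC //; first lia.
  by move=> /comparable_funC.
have ij : i != j by apply/eqP=> ij; apply: nmp; move: npq; rewrite -ei -{2}ej ij; case; left.
have ej' : join p q = step (step (meet p q) i) j.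
  apply/funext=> x; move/(congr1 (@^~ x)): ei; move/(congr1 (@^~ x)): ej.
  move: ij; rewrite /join /step /=; case: (eqVneq x i) => [->|_]; case: (eqVneq _ j) => //; lia.
by have := loc _ _ _ ij lm li lj; rewrite -ej' ei ej.
Qed.

Variable F : ('I_n -> int) -> R.
Hypotheses (kn : (0 < k < n)%N) (Fpos : forall g, is_lift k g -> 0 < F g).
Hypothesis Fsup : strictly_log_supermodular F.

Lemma log_supermodular p q : is_lift k p -> is_lift k q ->
  F p * F q <= F (meet p q) * F (join p q).
Proof.
move=> lp lq; case: (pselect (comparable_fun p q)) => [[pq|qp]|npq].
- by rewrite meet_fun_l // join_fun_r.
- by rewrite meet_funC join_funC meet_fun_l // join_fun_r // mulrC.
exact/ltW/Fsup.
Qed.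

Variables (T : ('I_n -> int) -> Prop) (m : R).
Hypotheses (hT : maximal_chain k T) (FT : forall g, T g -> F g = m).

(** With [g] and [step g i] in [T] as in [chain_floor], the meet of [w] and [step g i] is [g], so
    supermodularity gives [F w < F (join w (step g i))]. The join is strictly higher and still
    bounded by an element of [T], so repeating this ends in [T]. *)
Lemma lt_off_chain w : is_lift k w -> ~ T w -> F w < m.
Proof.
have [g0 Tg0] := chain_inhabited hT.
have m0 : 0 < m by rewrite -(FT Tg0); apply/Fpos/(chain_lift hT).
move=> lw nw; have [h [Th wh _]] := chain_ceil kn hT w Tg0.
move: w h wh lw nw Th; apply: total_ind => w h IH wh lw nw Th.
have [g [i [Tg Ti gw wi]]] := chain_floor kn hT lw nw.
have inc : ~ comparable_fun w (step g i).
  case=> [ws|/(_ i)]; last by rewrite step_self; lia.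
  by case: (between_step gw ws) => e; apply: nw; rewrite e.
have em : meet w (step g i) = g.
  apply/funext=> x; move: (gw x); rewrite /meet /step.
  by case: (eqVneq x i) => [->|_]; lia.
have := Fsup lw (chain_lift hT Ti) inc; rewrite em (FT Tg) (FT Ti) mulrC ltr_pM2l //.
move/lt_le_trans; apply; case: (pselect (T (join w (step g i)))) => [/FT -> //|nj].
have wj : le_fun w (join w (step g i)) by move=> x; rewrite /join; lia.
apply/ltW/(IH _ h) => //.
- have := lt_total_fun wj; have -> : (w = join w (step g i)) = False.
    by apply/propext; split=> // e; apply: inc; right => x; rewrite e /join; lia.
  by move=> /(_ id); lia.
- have sh : le_fun (step g i) h.
    case: (chain_comparable hT Ti Th) => // hs.
    by case: inc; left; apply: le_fun_trans hs.
  by move=> x; move: (wh x) (sh x); rewrite /join; lia.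
- exact: is_lift_join lw (chain_lift hT Ti).
Qed.

Section Wall.
Variables (w g : 'I_n -> int) (i j : 'I_n).
Hypotheses (Tg : T g) (Ti : T (step g i)) (Tij : T (step (step g i) j)).
Hypotheses (lw : is_lift k w) (wi : w i <= g i) (wj : step g i j < w j).

Lemma wall_lift : is_lift k (step g j).
Proof.
rewrite -(wall_clamp wi wj); apply: is_lift_join (chain_lift hT Tg).
exact: is_lift_meet lw (chain_lift hT Tij).
Qed.

(* Replacing w by its meet or join with an element of T, where F is maximal, does not decrease F; clamping w into the interval of length 2 gives the flip. *)
Lemma wall_le : (forall h, is_lift k h -> F h <= m) ->
  F w <= F (step g j) /\ (w <> step g j -> F w < F (step g j)).
Proof.
move=> Fm; have m0 : 0 < m by rewrite -(FT Tg); apply/Fpos/(chain_lift hT).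
have lt := chain_lift hT Tij; have lg := chain_lift hT Tg.
have lm := is_lift_meet lw lt.
have p1 := Fpos lm; have p2 := Fpos lw; have p3 := Fpos wall_lift.
have a1 := log_supermodular lw lt; have a2 := log_supermodular lm lg.
have b1 := Fm _ (is_lift_join lw lt); have b2 := Fm _ (is_lift_meet lm lg).
rewrite (wall_clamp wi wj) (FT Tg) in a2; rewrite (FT Tij) in a1.
have c1 : F w <= F (meet w (step (step g i) j)).
  by rewrite -(ler_pM2r m0) (le_trans a1) // ler_pM2l.
have c2 : F (meet w (step (step g i) j)) <= F (step g j).
  by rewrite -(ler_pM2r m0) (le_trans a2) // mulrC ler_pM2l.
split; first exact: le_trans c1 c2.
(* If [w] is not the flip itself, at least one of the two clamping operations involves an
   incomparable pair, and its inequality is strict. *)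
move=> ne; case: (pselect (comparable_fun w (step (step g i) j))) => [[wt|/(_ i)]|nc1].
- case: (pselect (comparable_fun (meet w (step (step g i) j)) g)) => [|nc2].
    rewrite meet_fun_l // => -[/(_ j)|gw]; first by have := le_step g i j; lia.
    case: ne; rewrite -(wall_clamp wi wj) meet_fun_l // join_funC join_fun_r //.
  have := Fsup lm lg nc2; rewrite (wall_clamp wi wj) (FT Tg) => a3.
  apply: le_lt_trans c1 _.
  by rewrite -(ltr_pM2r m0) (lt_le_trans a3) // mulrC ler_pM2l.
- by rewrite {1}/step step_self; lia.
apply: lt_le_trans c2; rewrite -(ltr_pM2r m0).
have := Fsup lw lt nc1; rewrite (FT Tij) => a3.
by rewrite (lt_le_trans a3) // ler_pM2l.
Qed.

End Wall.
End Supermodular.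

(** * Sorted collections and minors on lifts *)

Lemma ord_predE n (s : 'I_n) :
  ord_pred s = (if s == 0%N :> nat then n.-1 else s.-1) :> nat.
Proof.
case: s => -[|s] hs /=; first by rewrite add0n modn_small // ltn_predL.
by rewrite modnDr modn_small // ltnW.
Qed.

(** In the cyclic order [i - 1], [i], [j - 1], [j] the chords from [i] to [j] and from [i - 1] to
    [j - 1] cross. As in Ptolemy's theorem, the product of the crossing pair is then the sum of the
    other two in absolute value; these are the sign conditions for it. *)
Lemma square_signs (R : realFieldType) n (i j : 'I_n) : uniq [:: i; j; ord_pred i; ord_pred j] ->
  let d (s t : 'I_n) : R := t%:R - s%:R in
  0 < d i j * d (ord_pred i) (ord_pred j) * (d i (ord_pred j) * d (ord_pred i) j) /\
  0 < d i j * d (ord_pred i) (ord_pred j) * (d i (ord_pred i) * d j (ord_pred j)).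
Proof.
move=> hu d; have sg s t : s != t -> Num.sg (d s t) = if (s < t)%N then 1 else -1.
  move=> st; case: ltngtP => h; rewrite /d.
  - by rewrite gtr0_sg // subr_gt0 ltr_nat.
  - by rewrite ltr0_sg // subr_lt0 ltr_nat.
  by case/eqP: st; apply: val_inj.
move: hu; rewrite /= !inE !negb_or.
move=> /and4P[/and3P[ij ipi ipj] /andP[jpi jpj] pp _].
have pij : ord_pred i != j by rewrite eq_sym.
rewrite -![0 < _ * _]sgr_gt0 !sgrM !sg //.
have ne (s t : 'I_n) : s != t -> (s : nat) != t by rewrite (inj_eq val_inj).
move: (ne _ _ ij) (ne _ _ ipi) (ne _ _ ipj) (ne _ _ jpi) (ne _ _ jpj) (ne _ _ pp).
move: (ord_predE i) (ord_predE j) (ltn_ord i) (ltn_ord j).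
move: (nat_of_ord i) (nat_of_ord j) (nat_of_ord (ord_pred i)) (nat_of_ord (ord_pred j)).
move=> a b p q hp hq ha hb h1 h2 h3 h4 h5 h6.
have key e1 e2 e3 e4 e5 e6 : (a < b)%N = e1 -> (p < q)%N = e2 -> (a < q)%N = e3 ->
    (p < b)%N = e4 -> (a < p)%N = e5 -> (b < q)%N = e6 ->
    ~~ odd (e1 + e2 + e3 + e4) -> ~~ odd (e1 + e2 + e5 + e6) ->
    0 < (if (a < b)%N then 1 else -1) * (if (p < q)%N then 1 else -1) *
      ((if (a < q)%N then 1 else -1) * (if (p < b)%N then 1 else -1)) :> R /\
    0 < (if (a < b)%N then 1 else -1) * (if (p < q)%N then 1 else -1) *
      ((if (a < p)%N then 1 else -1) * (if (b < q)%N then 1 else -1)) :> R.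
  move=> -> -> -> -> -> ->.
  by case: e1; case: e2; case: e3; case: e4; case: e5; case: e6 => //= _ _;
    rewrite !(mulr1, mulrN1, mulN1r, opprK) ltr01.
(* The wrap-around of the predecessor affects only [i = 0] or [j = 0], which are treated
   separately. *)
case: (posnP a) hp => [a0 /=|a0 hp].
  by move=> hp; apply: (key true false true false true false) => //; move: hq; case: (eqVneq b 0%N) => *; lia.
case: (posnP b) hq => [b0 /=|b0 hq].
  by move=> hq; apply: (key false true true false false true) => //; move: hp => /= *; lia.
move: hp hq => /= hp hq.
by apply: (key (a < b)%N (a < b)%N (a < b)%N (a < b)%N false false) => //; last first;
  [case: ltnP|case: ltnP|lia|lia|lia|lia|lia].
Qed.

Section Lifts.
Variables (k n : nat) (I0 : ksubset k n).
Hypothesis kn : (0 < k < n)%N.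
Implicit Types (g h w : 'I_n -> int) (I : ksubset k n) (J : {set ksubset k n}).

Let n0 : (0 < n)%N.
Proof. by case/andP: kn => _; apply: leq_trans. Qed.

Let n1 : (1 < n)%N.
Proof. by case/andP: kn; apply: leq_ltn_trans. Qed.

(** [I0] is a default value for supports of the wrong size; lifts always have supports of size
    [k]. *)
Definition ksub g : ksubset k n := insubd I0 (supp k g).

Lemma val_ksub g : is_lift k g -> val (ksub g) = supp k g.
Proof. by move=> hg; rewrite val_insubd card_supp // eqxx. Qed.

Lemma ksub_lift_of I : ksub (lift_of I) = I.
Proof. by apply: val_inj; rewrite val_ksub ?supp_lift_of //; apply: is_lift_of. Qed.

Lemma ksub_shift g c : ksub (shift g c) = ksub g.
Proof. by rewrite /ksub supp_shift. Qed.

Lemma ksub_eq_shift g h : is_lift k g -> is_lift k h -> ksub g = ksub h ->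
  exists c, h = shift g c.
Proof.
by move=> hg hh e; apply: (lift_determined hg hh); rewrite -!val_ksub // e.
Qed.

Definition lifts J g := is_lift k g /\ ksub g \in J.

Lemma lifts_shift J g c : lifts J g -> lifts J (shift g c).
Proof. by move=> [lg gJ]; split; [apply: is_lift_shift|rewrite ksub_shift]. Qed.

Lemma sorted_collectionP J :
  sorted_collection J <-> forall g h, lifts J g -> lifts J h -> comparable_fun g h.
Proof.
split=> [/forallP hJ g h [lg gJ] [lh hJ']|H].
  have /implyP/(_ gJ)/forallP/(_ (ksub h))/implyP/(_ hJ') := hJ (ksub g).
  by move=> /(sorted_pair_comparable _ _ n0); apply; rewrite // val_ksub.
apply/forallP=> I; apply/implyP=> IJ; apply/forallP=> I'; apply/implyP=> I'J.
apply/(sorted_pair_comparable _ _ n0) => g h lg lh eg eh.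
have ksubE p X : is_lift k p -> supp k p = val X -> ksub p = X.
  by move=> lp e; apply: val_inj; rewrite val_ksub.
by apply: H; split=> //; [rewrite (ksubE _ _ lg eg)|rewrite (ksubE _ _ lh eh)].
Qed.

Lemma comparable_fun_shift_self g c : comparable_fun g (shift g c).
Proof.
by case: (lerP 0 c) => hc; [left|right] => x; rewrite /shift; lia.
Qed.

(** If [w] is comparable to all lifts of [J], adding its subset keeps the collection sorted, so the
    subset already belongs to [J]. *)
Lemma maxset_maximal_chain J : maxset (@sorted_collection k n) J ->
  maximal_chain k (lifts J).
Proof.
move=> /maxsetP[sJ mJ].
have ext w : is_lift k w -> (forall g, lifts J g -> comparable_fun w g) -> ksub w \in J.
  move=> lw hw; rewrite -(mJ (ksub w |: J)) ?setU11 ?subsetU1 //.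
  apply/sorted_collectionP => g h [lg gJ] [lh hJ].
  move: gJ hJ; rewrite !in_setU1.
  have sh p : is_lift k p -> ksub p = ksub w ->
      forall q, lifts J q -> comparable_fun p q.
    move=> lp e q Tq; have [c ->] := ksub_eq_shift lw lp (esym e).
    have := hw _ (lifts_shift (- c) Tq).
    by case=> le; [left|right] => x; move: (le x); rewrite /shift; lia.
  case/orP=> [/eqP eg|gJ] /orP[/eqP eh|hJ].
  - have [c ->] := ksub_eq_shift lg lh (etrans eg (esym eh)).
    exact: comparable_fun_shift_self.
  - exact: sh.
  - by apply: comparable_funC; apply: sh.
  by have /sorted_collectionP := sJ; apply.
split.
- by move=> g [].
- by move=> g c; apply: lifts_shift.
- exact/sorted_collectionP.
- by move=> w lw hw; split=> //; apply: ext.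
(* An empty [J] would be comparable to everything vacuously, and [I0] would have to belong to it. *)
case: (set_0Vmem J) => [e|[I IJ]].
  suff : ksub (lift_of I0) \in J by rewrite e inE.
  by apply: ext => [|g [_]]; [apply: is_lift_of|rewrite e inE].
by exists (lift_of I); split; [apply: is_lift_of|rewrite ksub_lift_of].
Qed.

Section Minors.
Variables (R : realType) (A : 'M[R]_(k, n)).

(** The four corners of a unit square share the set [C]; they differ in the choice between [i] and
    its predecessor and between [j] and its predecessor. The order of the four points is that of
    [x], [y], [z], [w] in the exchange relation. *)
Lemma square_sets g i j : i != j -> is_lift k g -> is_lift k (step g i) ->
  is_lift k (step g j) ->
  let C := supp k g :\ i :\ j in
  [/\ uniq [:: i; j; ord_pred i; ord_pred j],
      all (fun s => s \notin C) [:: i; j; ord_pred i; ord_pred j],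
      val (ksub g) = i |: (j |: C) /\
        val (ksub (step (step g i) j)) = ord_pred i |: (ord_pred j |: C),
      val (ksub (step g j)) = i |: (ord_pred j |: C)
    & val (ksub (step g i)) = ord_pred i |: (j |: C)].
Proof.
move=> ij lg li lj C; have lij := step_square ij li lj.
have [si pi ei] := slope_step n1 lg li; have [sj pj ej] := slope_step n1 lg lj.
have [_ _ eij] := slope_step n1 li lij.
have gi : i \in supp k g by rewrite inE si.
have gj : j \in supp k g by rewrite inE sj.
have gpi : ord_pred i \notin supp k g by rewrite inE pi.
have gpj : ord_pred j \notin supp k g by rewrite inE pj.
have ipi : i != ord_pred i by apply: contraNneq gpi => <-.
have ipj : i != ord_pred j by apply: contraNneq gpj => <-.
have jpi : j != ord_pred i by apply: contraNneq gpi => <-.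
have jpj : j != ord_pred j by apply: contraNneq gpj => <-.
have pp : ord_pred i != ord_pred j by rewrite (inj_eq (@ord_pred_inj n)).
have gD1 (S : {set 'I_n}) x : x \in S -> x |: (S :\ x) = S by apply: setD1K.
have nj : j \in supp k g :\ i by rewrite in_setD1 eq_sym ij gj.
have ni : i \in supp k g :\ j by rewrite in_setD1 ij gi.
split.
- by rewrite /= !inE !negb_or ij ipi ipj jpi jpj pp.
- by rewrite /= !in_setD1 !eqxx (negPf gpi) (negPf gpj) !andbF.
- rewrite !val_ksub // /C gD1 // gD1 //; split=> //.
  rewrite eij ei; apply/setP=> x; rewrite !(in_setU1, in_setD1).
  case: (eqVneq x j) => [->|xj]; first by rewrite (negPf jpi) (negPf jpj).
  by rewrite /= orbCA.
- rewrite val_ksub // ej /C; apply/setP=> x; rewrite !(in_setU1, in_setD1).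
  by case: (eqVneq x i) => [->|xi]; rewrite ?ij ?gi ?orbT.
- by rewrite val_ksub // ei /C gD1.
Qed.

Hypothesis hA : Gr_pos A.

Lemma minor_supermodular : strictly_log_supermodular k (fun g => minor A (ksub g)).
Proof.
apply: local_global_supermodular => // [g _|g i j ij lg li lj]; first by case: hA.
have [hu hC [e1 e2] e3 e4] := square_sets ij lg li lj.
have [s1 s2] := square_signs R hu.
rewrite mulrC; apply: (minor_exchange _ hu hC e1 e2 e3 e4 hA) => //.
by case/andP: kn => _ /ltnW.
Qed.

End Minors.
End Lifts.

(** * Rescaling columns *)

Section Torus.
Variables (R : realType) (k n : nat).
Implicit Types (A : 'M[R]_(k, n)) (tau : 'I_n -> R) (I : ksubset k n).

Definition rescale A tau : 'M[R]_(k, n) := \matrix_(i, j) (A i j * tau j).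

Lemma minor_rescale A tau I :
  minor (rescale A tau) I = minor A I * \prod_(x in val I) tau x.
Proof.
rewrite /minor.
have -> : colsub (ksubset_elt I) (rescale A tau) =
    colsub (ksubset_elt I) A *m diag_mx (\row_j tau (ksubset_elt I j)).
  by apply/matrixP=> i j; rewrite mul_mx_diag !mxE.
rewrite det_mulmx det_diag; congr (_ * _).
have <- : [set ksubset_elt I i | i : 'I_k] = val I.
  apply/eqP; rewrite eqEcard card_imset ?card_ord; last exact: ksubset_elt_inj.
  rewrite card_ksubset leqnn andbT; apply/subsetP=> y /imsetP[i _ ->].
  exact: mem_ksubset_elt.
rewrite big_imset /=; last by move=> i j _ _; apply: ksubset_elt_inj.
by apply: eq_big => i //=; rewrite mxE.
Qed.

Lemma Gr_pos_rescale A tau : (k <= n)%N -> Gr_pos A -> (forall x, 0 < tau x) ->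
  Gr_pos (rescale A tau).
Proof.
move=> kn [_ hA] ht; apply: Gr_pos_minors => // I; rewrite minor_rescale.
by apply: mulr_gt0 => //; apply: prodr_gt0.
Qed.

Variables (I0 : ksubset k n) (T : ('I_n -> int) -> Prop).
Hypotheses (kn : (0 < k < n)%N) (hT : maximal_chain k T).

(* Along a step of the chain at i, the i-th element of the k-subset is replaced by its predecessor, so the minor is multiplied by tau (i - 1) / tau i; the n - 1 ratios with i <> 0 can be prescribed, and the remaining step is implied by periodicity. *)
Lemma rescale_constant_on_chain A : Gr_pos A ->
  exists tau, (forall x, 0 < tau x) /\
  exists m, forall g, T g -> minor (rescale A tau) (ksub I0 g) = m.
Proof.
move=> [_ hA]; have n1 : (1 < n)%N by case/andP: kn; apply: leq_ltn_trans.
have n0 : (0 < n)%N by apply: ltnW.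
pose F g := minor A (ksub I0 g).
have Fpos g : 0 < F g by apply: hA.
(* The ratio belongs to [i] alone: all steps of [T] at [i] are shifts of one another, and shifts do
   not change the subset. *)
have ex i : exists r, 0 < r /\ forall g, T g -> T (step g i) -> F (step g i) = r * F g.
  have [g0 [Tg0 Tgi0]] := chain_step_exists kn hT i.
  exists (F (step g0 i) / F g0); split; first exact: divr_gt0.
  move=> g Tg Tgi; have [c ->] := chain_step_shift kn hT Tg0 Tgi0 Tg Tgi.
  by rewrite -shift_step /F !ksub_shift divfK // gt_eqF //; apply: hA.
have [rho hrho] := choice ex.
(* The product telescopes, so that [tau i / tau (i - 1) = rho i] for [i] other than 0, cancelling
   the change of the minor along a step at [i]. *)
pose tau (i : 'I_n) := \prod_(x : 'I_n | (0 < x <= i)%N) rho x.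
have tpos x : 0 < tau x by apply: prodr_gt0 => i _; case: (hrho i).
pose i0 : 'I_n := Ordinal n0.
have tauS i : i != i0 -> tau i = rho i * tau (ord_pred i).
  move=> ii; have i_gt0 : (0 < i)%N.
    by rewrite lt0n; apply: contraNneq ii => e; apply/eqP/val_inj.
  rewrite /tau (bigD1 i) /= ?i_gt0 ?leqnn //; congr (_ * _).
  apply: eq_bigl => x; rewrite -(inj_eq val_inj) /=.
  have -> : ((i + n).-1 %% n)%N = i.-1.
    have -> : (i + n).-1 = (i.-1 + n)%N by lia.
    by rewrite modnDr modn_small //; have := ltn_ord i; lia.
  lia.
exists tau; split=> //; have [g0 Tg0] := chain_inhabited hT.
exists (minor (rescale A tau) (ksub I0 g0)) => g Tg.
apply: (chain_constant kn hT (phi := fun g => minor (rescale A tau) (ksub I0 g)) (i0 := i0)) => //.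
  by move=> h c; rewrite ksub_shift.
move=> h i Th Ti ii; have lh := chain_lift hT Th; have li := chain_lift hT Ti.
have [si pi ei] := slope_step n1 lh li.
rewrite !minor_rescale !val_ksub // ei.
have hi : i \in supp k h by rewrite inE si.
have hpi : ord_pred i \notin supp k h :\ i.
  by rewrite in_setD1 negb_and; apply/orP; right; rewrite inE pi.
rewrite big_setU1 //= (big_setD1 i hi) /= (tauS i) //.
have := proj2 (hrho i) h Th Ti; rewrite /F => ->; ring.
Qed.

End Torus.

(** * Vandermonde nodes favouring a prescribed flip *)

Section Points.
Variable n : nat.
Implicit Types (x y a b c d : 'I_n).

(* Rotating so that the predecessor of a comes first, the points are spaced by n^2, except that a and b are at distance 1 from their predecessors. *)
Lemma exists_close_points a b : uniq [:: a; b; ord_pred a; ord_pred b] ->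
  exists (p : 'I_n -> int) (theta : int),
  (forall x y, (x < y)%N -> 0 < (p y - p x) * ((2 * p x - theta) * (2 * p y - theta))) /\
  (forall c d, uniq [:: c; d; ord_pred c; ord_pred d] ->
    `|p a - p (ord_pred a)| * `|p b - p (ord_pred b)| *
      (`|p d - p c| * `|p (ord_pred d) - p (ord_pred c)|) <=
    `|p c - p (ord_pred c)| * `|p d - p (ord_pred d)| *
      (`|p b - p a| * `|p (ord_pred b) - p (ord_pred a)|)).
Proof.
move=> hu.
pose rot x : nat := if (ord_pred a <= x)%N then (x - ord_pred a)%N
  else (x + n - ord_pred a)%N.
have rot_lt x : (rot x < n)%N.
  rewrite /rot; have := ltn_ord x; have := ltn_ord (ord_pred a).
  by move: (nat_of_ord (ord_pred a)) (nat_of_ord x) => q y hq hy; case: ifP; lia.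
have rot_inj x y : rot x = rot y -> x = y.
  move=> e; apply: val_inj; move: e; rewrite /rot -[val x]/(nat_of_ord x) -[val y]/(nat_of_ord y).
  have := ltn_ord x; have := ltn_ord y; have := ltn_ord (ord_pred a).
  move: (nat_of_ord (ord_pred a)) (nat_of_ord x) (nat_of_ord y) => q s t hq ht hs.
  by do 2!case: ifP; lia.
have rot_pred x : rot (ord_pred x) = if rot x == 0%N then n.-1 else (rot x).-1.
  rewrite /rot (ord_predE x).
  have := ltn_ord x; have := ltn_ord (ord_pred a).
  move: (nat_of_ord (ord_pred a)) (nat_of_ord x) => q y hq hy.
  by case: (leqP q y) => h1; case: (eqVneq y 0%N) => h2 /=; do ![case: ifP => ?]; lia.
have rot_a' : rot (ord_pred a) = 0%N by rewrite /rot leqnn subnn.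
have rot_a : rot a = 1%N.
  have := rot_pred a; rewrite rot_a'; have := rot_lt a; case: eqVneq; last lia.
  move=> ea; have : rot a = rot (ord_pred a) by rewrite rot_a'.
  by move/rot_inj => e; move: hu; rewrite -e /= !inE eqxx !orbT.
have rot_neq x y : x != y -> rot x != rot y.
  by apply: contraNneq => /rot_inj ->.
pose B := rot b.
have hB : (3 <= B)%N /\ rot (ord_pred b) = B.-1.
  move: hu; rewrite /= !inE !negb_or => /and4P[/and3P[ab _ ab'] /andP[ba' _] _ _].
  have := rot_neq _ _ ab; have := rot_neq _ _ ab'; have := rot_neq _ _ ba'.
  rewrite (rot_pred b) -/B rot_a rot_a'; case: eqVneq => //; lia.
have nB : (B < n)%N by apply: rot_lt.
pose N : int := (n * n)%N%:Z.
(* [r] is the rank after rotation and spacing is [N]; the two gaps below ranks 1 and [B], those of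
   [a] and [b], are shortened to 1. *)
pose P (r : nat) : int := N * r%:Z - (N - 1) * ((0 < r)%N%:R + (B <= r)%N%:R).
have N1 : 1 <= N by rewrite /N; nia.
have [B3 rot_b'] := hB.
have P_lt r s : (r < s)%N -> 1 <= P s - P r.
  by rewrite /P; do ![case: (posnP _) => ?]; do ![case: (leqP B _) => ?] => *; nia.
have P_far r s : (r.+1 < s)%N -> N <= P s - P r.
  by rewrite /P; do ![case: (posnP _) => ?]; do ![case: (leqP B _) => ?] => *; nia.
have P_near r : r != 0%N -> r.+1 != B -> N <= P r.+1 - P r.
  by rewrite /P; do ![case: (posnP _) => ?]; do ![case: (leqP B _) => ?] => *; nia.
have P_max r s : (s < n)%N -> P s - P r <= N * n%:Z.
  by rewrite /P; do ![case: (posnP _) => ?]; do ![case: (leqP B _) => ?] => *; nia.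
have P_a : P 1%N - P 0%N = 1.
  by rewrite /P /=; do ![case: (leqP B _) => ?] => *; lia.
have P_b : P B - P B.-1 = 1.
  by rewrite /P; do ![case: (posnP _) => ?]; do ![case: (leqP B _) => ?] => *; nia.
pose p x := P (rot x).
have p_max x y : `|p x - p y| <= N * n%:Z.
  by have := P_max (rot x) _ (rot_lt y); have := P_max (rot y) _ (rot_lt x); rewrite /p; lia.
have p_min x y : x != y -> 1 <= `|p x - p y|.
  move/rot_neq; rewrite /p neq_ltn => /orP[] /P_lt; lia.
have p_far x y : (rot x).+1 != rot y -> (rot y).+1 != rot x -> x != y ->
    N <= `|p x - p y|.
  move=> h1 h2 /rot_neq h3.
  have [/P_far|/P_far] : ((rot x).+1 < rot y)%N \/ ((rot y).+1 < rot x)%N by lia.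
    by rewrite /p; lia.
  by rewrite /p; lia.
have p_aa : `|p a - p (ord_pred a)| = 1 by rewrite /p rot_a rot_a' P_a.
have p_bb : `|p b - p (ord_pred b)| = 1 by rewrite /p rot_b' P_b.
have p_ab : N <= `|p b - p a|.
  by apply: p_far; rewrite ?rot_a -/B; [lia|lia|apply: contraTneq B3 => e; rewrite /B e rot_a].
have p_ab' : N <= `|p (ord_pred b) - p (ord_pred a)|.
  apply: p_far; rewrite ?rot_a' ?rot_b'; [lia|lia|].
  by apply/eqP => /(congr1 rot); rewrite rot_a' rot_b'; lia.
have p_cc c : c != a -> c != b -> N <= `|p c - p (ord_pred c)|.
  move=> /rot_neq; rewrite rot_a => ca /rot_neq; rewrite -/B => cb.
  have := rot_pred c; case: eqVneq => [c0 e|c0 e].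
    apply: p_far; rewrite ?e ?c0; [lia|lia|].
    by apply/eqP => /(congr1 rot); rewrite e c0; lia.
  by rewrite /p e -{1}[rot c]prednK ?lt0n //; have := P_near (rot c).-1; rewrite prednK ?lt0n //; lia.
have pred_neq c : c != ord_pred c.
  by apply/eqP => /(congr1 rot); rewrite rot_pred; case: eqVneq; lia.
pose M := (n.-1 - ord_pred a)%N.
(* [M] is the rank of the last index [n - 1], so half of this odd number separates the nodes before
   the wrap-around from those after it and never equals a node. *)
exists p, (2 * P M + 1); split.
  have hM x : (2 * p x - (2 * P M + 1) < 0) = (ord_pred a <= x)%N.
    have e : (ord_pred a <= x)%N = (rot x <= M)%N.
      rewrite /M /rot; have := ltn_ord x; have := ltn_ord (ord_pred a).
      move: (nat_of_ord (ord_pred a)) (nat_of_ord x) => q y hq hy.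
      by case: ifP; lia.
    rewrite e; case: leqP => [|/P_lt]; last by rewrite /p; lia.
    by rewrite leq_eqVlt /p => /orP[/eqP ->|/P_lt]; lia.
  move=> x y xy; have := hM x; have := hM y.
  have ltp : (ord_pred a <= x)%N = (ord_pred a <= y)%N -> p x < p y.
    move=> e; have /P_lt : (rot x < rot y)%N; last by rewrite /p; lia.
    move: e xy; rewrite /rot; have := ltn_ord x; have := ltn_ord (ord_pred a).
    move: (nat_of_ord (ord_pred a)) (nat_of_ord x) (nat_of_ord y) => q s t hq hs.
    by case: ifP; case: ifP; lia.
  case: (leqP (ord_pred a) x) ltp => hx; case: (leqP (ord_pred a) y) => hy ltp h1 h2.
  - have hpx : 2 * p x - (2 * P M + 1) < 0 by lia.
    have hpy : 2 * p y - (2 * P M + 1) < 0 by lia.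
    by rewrite mulr_gt0 ?subr_gt0 ?ltp // nmulr_rgt0.
  - by move: (leq_trans hx (ltnW xy)) hy; lia.
  - have hpx : 0 < 2 * p x - (2 * P M + 1).
      by have := hM x; move: (p x) (P M) hx => s t; lia.
    have hpy : 2 * p y - (2 * P M + 1) < 0 by lia.
    by rewrite nmulr_rgt0 ?pmulr_rlt0 //; lia.
  - have hpx : 0 < 2 * p x - (2 * P M + 1) by lia.
    have hpy : 0 < 2 * p y - (2 * P M + 1) by lia.
    by rewrite mulr_gt0 ?subr_gt0 ?ltp // pmulr_rgt0.
move=> c d /=; rewrite !inE !negb_or => /and4P[/and3P[cd _ _] _ cd' _].
rewrite p_aa p_bb !mul1r.
have [[-> ->]|[[-> ->]|h]] : (c = a /\ d = b) \/ (c = b /\ d = a) \/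
    (c != a) && (c != b) || (d != a) && (d != b).
- case: (eqVneq c a) => [ca|ca].
    case: (eqVneq d b) => [db|db]; first by left.
    by right; right; rewrite -ca [d == c]eq_sym cd orbT.
  case: (eqVneq c b) => [cb|cb]; last by right; right.
  case: (eqVneq d a) => [da|da]; first by right; left.
  by right; right; rewrite -cb [d == c]eq_sym cd orbT.
- by rewrite p_aa p_bb !mul1r.
- by rewrite p_aa p_bb !mul1r distrC [X in _ * X]distrC.
have hL : N <= `|p c - p (ord_pred c)| * `|p d - p (ord_pred d)|.
  case/orP: h => /andP[h1 h2].
    by rewrite -[X in X <= _]mulr1 ler_pM ?p_cc ?p_min //; lia.
  by rewrite -[X in X <= _]mul1r ler_pM ?p_cc ?p_min //; lia.
have hK : `|p d - p c| * `|p (ord_pred d) - p (ord_pred c)| <= (N * n%:Z) * (N * n%:Z).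
  by apply: ler_pM.
have hM : N * N <= `|p b - p a| * `|p (ord_pred b) - p (ord_pred a)|.
  by apply: ler_pM => //; lia.
(* Here one of the gaps at [c] and [d] is long, and [N = n ^ 2] makes [(N * n) ^ 2] equal to
   [N * (N * N)]. *)
apply: le_trans hK _; rewrite (_ : _ * _ = N * (N * N)); first by apply: ler_pM => //; nia.
by rewrite mulrACA {3}/N; nia.
Qed.
End Points.

Section ExchangeRatio.
Variables (R : realType) (n : nat).
Implicit Types (u : 'I_n -> R) (a b c d : 'I_n).

(** By [flip_ratio] the minor of a flip is the largest minor times such a cross-ratio; the ratio for
    [c], [d] is compared with that for [a], [b], cross-multiplied. *)
Definition exchange_ratio_le u a b c d :=
  `|(u (ord_pred d) - u c) * (u d - u (ord_pred c))| *
    `|(u b - u a) * (u (ord_pred b) - u (ord_pred a))| <=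
  `|(u (ord_pred b) - u a) * (u b - u (ord_pred a))| *
    `|(u d - u c) * (u (ord_pred d) - u (ord_pred c))|.

(** This writes the cross-ratio of a flip as 1 minus a term proportional to the gaps between [c],
    [d] and their predecessors, so small gaps make it large. *)
Lemma increasing_plucker u c d : (forall x y : 'I_n, (x < y)%N -> u x < u y) ->
  uniq [:: c; d; ord_pred c; ord_pred d] ->
  `|(u d - u c) * (u (ord_pred d) - u (ord_pred c))| =
  `|(u (ord_pred d) - u c) * (u d - u (ord_pred c))| +
  `|(u (ord_pred c) - u c) * (u (ord_pred d) - u d)|.
Proof.
move=> hu huniq; have [s1 s2] := square_signs R huniq.
pose e (s t : 'I_n) : R := t%:R - s%:R.
have key s t p q : s != t -> p != q ->
    0 < ((u t - u s) * (u q - u p)) * (e s t * e p q * 1).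
  have same s' t' : s' != t' -> 0 < (u t' - u s') * e s' t'.
    rewrite -(inj_eq val_inj) neq_ltn => /orP[] /= h; rewrite /e.
      by rewrite mulr_gt0 ?subr_gt0 ?ltr_nat ?hu.
    by rewrite nmulr_rgt0 subr_lt0 ?ltr_nat ?hu.
  by move=> st pq; rewrite mulr1 mulrACA mulr_gt0 ?same.
move: huniq; rewrite /= !inE !negb_or => /and4P[/and3P[h1 h2 h3] /andP[h4 h5] h6 _].
by apply: (proj2 (signed_sum _ s1 s2 (key _ _ _ _ _ _) (key _ _ _ _ _ _) (key _ _ _ _ _ _)));
  rewrite // 1?eq_sym //; ring.
Qed.

Lemma exists_exchange_maximal a b : uniq [:: a; b; ord_pred a; ord_pred b] ->
  exists u, (forall x y : 'I_n, (x < y)%N -> u x < u y) /\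
    forall c d, uniq [:: c; d; ord_pred c; ord_pred d] -> exchange_ratio_le u a b c d.
Proof.
move=> hab; have [p [theta [hp hcd]]] := exists_close_points hab.
pose q x : R := (2 * p x - theta)%:~R.
(* The Moebius map t |-> -1/t undoes the rotation and preserves cross-ratios. *)
pose u x : R := - (q x)^-1.
have q0 x : q x != 0.
  rewrite intr_eq0; apply/eqP => e.
  case: (ltngtP x a) => [/hp|/hp|/val_inj xa].
  - by rewrite e; lia.
  - by rewrite e; lia.
  move: hab => /= /andP[]; rewrite !inE !negb_or => /andP[ab _] _.
  by move: ab; rewrite -(inj_eq val_inj) neq_ltn => /orP[] /hp; rewrite -xa e; lia.
have uE x y : u y - u x = 2 * (p y - p x)%:~R / (q x * q y).
  have e : q y - q x = 2 * (p y - p x)%:~R.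
    by rewrite /q -rmorphB /= -[2 in RHS]/(2%:~R) -rmorphM /=; congr (_%:~R); ring.
  rewrite /u -e; move: (q x) (q y) (q0 x) (q0 y) => s t hs ht.
  by field; rewrite hs ht.
have uinc (x y : 'I_n) : (x < y)%N -> u x < u y.
  move=> /hp h; rewrite -subr_gt0 uE.
  have qq : 0 < (q x * q y) ^+ 2 by rewrite exprn_even_gt0 //= mulf_neq0.
  have -> : 2 * (p y - p x)%:~R / (q x * q y) =
      2 * ((p y - p x)%:~R * (q x * q y)) / (q x * q y) ^+ 2.
    by move: (q x) (q y) (q0 x) (q0 y) => s t hs ht; field; rewrite hs ht.
  by rewrite divr_gt0 // mulr_gt0 // /q -!rmorphM /= ltr0z.
exists u; split=> // c d huniq.
have Kcd := increasing_plucker uinc huniq; have Kab := increasing_plucker uinc hab.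
(* After substituting the three-term relations, the common product on both sides cancels and only
   the terms with neighbouring gaps are compared. *)
suff : `|(u (ord_pred a) - u a) * (u (ord_pred b) - u b)| *
      `|(u d - u c) * (u (ord_pred d) - u (ord_pred c))| <=
    `|(u (ord_pred c) - u c) * (u (ord_pred d) - u d)| *
      `|(u b - u a) * (u (ord_pred b) - u (ord_pred a))|.
  rewrite /exchange_ratio_le Kcd Kab.
  set M1 := `|_|; set L1 := `|_|; set M2 := `|_|; set L2 := `|_|; lra.
have normE x y : `|u y - u x| = 2 * `|p y - p x|%:~R * (`|q x|^-1 * `|q y|^-1).
  by rewrite uE !normrM normfV normrM invfM intr_norm normr_nat.
have := hcd c d huniq; rewrite -(ler_int R) !rmorphM /= => h.
rewrite !normrM !normE.
have v x : 0 < `|q x|^-1 by rewrite invr_gt0 normr_gt0.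
rewrite (distrC (p (ord_pred a))) (distrC (p (ord_pred b)) (p b)).
rewrite (distrC (p (ord_pred c)) (p c)) (distrC (p (ord_pred d)) (p d)).
(* Each of [a], [b], [c], [d] and their predecessors enters once on either side, so the Moebius map
   contributes the same factor [V] to both. *)
pose V := 2 ^+ 4 * (`|q a|^-1 * `|q b|^-1 * `|q c|^-1 * `|q d|^-1 *
  (`|q (ord_pred a)|^-1 * `|q (ord_pred b)|^-1 * `|q (ord_pred c)|^-1 * `|q (ord_pred d)|^-1)).
have V0 : 0 < V by rewrite /V !mulr_gt0 ?exprn_gt0.
rewrite -(ler_pM2l V0) in h.
by apply: le_trans (le_trans h _); rewrite le_eqVlt; apply/orP; left; apply/eqP; rewrite /V; ring.
Qed.

End ExchangeRatio.

(** * Facets and second largest minors *)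

Lemma le_of_cross_products (R : realFieldType) (m x1 x2 a1 a2 b1 b2 : R) :
  0 < m -> 0 < a1 -> 0 < a2 -> x1 * a1 = m * b1 -> x2 * a2 = m * b2 ->
  b1 * a2 <= b2 * a1 -> x1 <= x2.
Proof.
move=> m0 a10 a20 e1 e2 h; rewrite -(ler_pM2r (mulr_gt0 a10 a20)).
rewrite mulrA e1 [a1 * a2]mulrC mulrA e2 -!mulrA.
by rewrite ler_pM2l.
Qed.

Section RescaledRatio.
Variables (R : realType) (k n : nat).

(** [I1], [I2] and [I3], [I4] have the same union with multiplicities, so the column factors are
    equal on both sides. *)
Lemma minor_rescaled_vandermonde_ratio (C : {set 'I_n}) x y z w
    (I1 I2 I3 I4 : ksubset k n) (u tau : 'I_n -> R) :
  (k <= n)%N -> uniq [:: x; y; z; w] ->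
  all (fun s => s \notin C) [:: x; y; z; w] ->
  val I1 = x |: (y |: C) -> val I2 = z |: (w |: C) ->
  val I3 = x |: (w |: C) -> val I4 = z |: (y |: C) ->
  Gr_pos (vandermonde k u) ->
  let F I := minor (rescale (vandermonde k u) tau) I in
  F I3 * F I4 * `|(u y - u x) * (u w - u z)| =
  F I1 * F I2 * `|(u w - u x) * (u y - u z)|.
Proof.
move=> kn hu hC e1 e2 e3 e4 hA F.
have E := minor_vandermonde_ratio kn hu hC e1 e2 e3 e4 hA.
move: hu hC; rewrite /= !inE !negb_or.
move=> /and4P[/and3P[xy xz xw] /andP[yz yw] zw _] /and5P[xC yC zC wC _].
have prodE s t : s != t -> s \notin C -> t \notin C ->
    \prod_(v in s |: (t |: C)) tau v = tau s * (tau t * \prod_(v in C) tau v).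
  move=> st sC tC; rewrite big_setU1 /= ?in_setU1 ?negb_or ?st //.
  by rewrite big_setU1.
rewrite /F !minor_rescale e1 e2 e3 e4 !prodE //; last by rewrite eq_sym.
rewrite [LHS](_ : _ = (minor (vandermonde k u) I3 * minor (vandermonde k u) I4 *
    `|(u y - u x) * (u w - u z)|) * (tau x * tau y * tau z * tau w *
    (\prod_(v in C) tau v) ^+ 2)); last by ring.
by rewrite E; ring.
Qed.

End RescaledRatio.

Section Facets.
Variables (R : realType) (k n : nat) (I0 : ksubset k n).
Hypothesis kn : (0 < k < n)%N.
Implicit Types (J Q : {set ksubset k n}) (I W : ksubset k n) (A : 'M[R]_(k, n)).

Let n1 : (1 < n)%N.
Proof. by case/andP: kn; apply: leq_ltn_trans. Qed.

Let n0 : (0 < n)%N. Proof. exact: ltnW. Qed.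

Let le_kn : (k <= n)%N. Proof. by case/andP: kn => _ /ltnW. Qed.

(** Two incomparable lifts of largest minors would have a meet and a join whose minors have a larger
    product. *)
Lemma sorted_argmax A : Gr_pos A -> sorted_collection (argmax_minors A).
Proof.
move=> hA; apply/(sorted_collectionP I0 kn) => g h [lg /argmax_minorsP hg] [lh /argmax_minorsP hh].
apply: contrapT => nc; have := minor_supermodular I0 kn hA lg lh nc.
apply/negP; rewrite -leNgt /=; case: hA => _ Apos.
by apply: ler_pM => //; apply: ltW.
Qed.

Section MaximalSorted.
Variable J : {set ksubset k n}.
Hypothesis hJ : maxset (@sorted_collection k n) J.

Let T := lifts I0 J.
Let hT : maximal_chain k T := maxset_maximal_chain I0 kn hJ.

Lemma lift_of_in_chain I : T (lift_of I) <-> I \in J.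
Proof.
rewrite /T /lifts ksub_lift_of //; split=> [[]//|h]; split=> //; exact: is_lift_of.
Qed.

Lemma largest_of_chain A : Gr_pos A -> exists tau,
  [/\ Gr_pos (rescale A tau), argmax_minors (rescale A tau) = J
    & exists m, forall g, T g -> minor (rescale A tau) (ksub I0 g) = m].
Proof.
move=> hA; have [tau [tpos [m hm]]] := rescale_constant_on_chain I0 kn hT hA.
have hB := Gr_pos_rescale le_kn hA tpos.
exists tau; split=> //; last by exists m.
have off I : I \notin J -> minor (rescale A tau) I < m.
  move=> nI; rewrite -(ksub_lift_of I0 kn I).
  apply: (lt_off_chain kn _ (minor_supermodular I0 kn hB) hT hm (is_lift_of I)).
    by move=> g _; case: hB.
  by move/lift_of_in_chain => IJ; rewrite IJ in nI.
have on I : I \in J -> minor (rescale A tau) I = m.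
  by move/lift_of_in_chain => /hm; rewrite ksub_lift_of.
have [g0 Tg0] := chain_inhabited hT; have g0J : ksub I0 g0 \in J by case: Tg0.
apply/setP=> I; apply/argmax_minorsP/idP => [h|IJ I'].
  apply: contraLR (h (ksub I0 g0)) => /off; by rewrite (on _ g0J) -ltNge.
by rewrite (on I IJ); case: (boolP (I' \in J)) => [/on ->|/off /ltW].
Qed.

(** A step changes the total by 1, a shift by a multiple of [n], and [n > 1]. *)
Lemma ksub_step_neq g i : is_lift k g -> is_lift k (step g i) ->
  ksub I0 (step g i) != ksub I0 g.
Proof.
move=> lg li; apply/eqP => /esym /(ksub_eq_shift kn lg li)[c /(congr1 (@total n))].
rewrite total_step total_shift => e; have := n1.
by case: (lerP c 0) => hc; nia.
Qed.

(** Sending [i] to the subset from which the chain steps at [i] is a bijection onto [J], since every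
    element of [T] has exactly one next step. *)
Lemma card_maxset_sorted : #|J| = n.
Proof.
have [G hG] := choice (chain_step_exists kn hT).
suff -> : J = [set ksub I0 (G i) | i : 'I_n].
  rewrite card_imset ?card_ord // => i j e.
  have [[Ti Tii] [Tj Tjj]] := (hG i, hG j).
  have [c ec] := ksub_eq_shift kn (chain_lift hT Ti) (chain_lift hT Tj) e.
  have := chain_shift hT c Tii; rewrite shift_step -ec => Tji.
  exact: (chain_step_unique kn hT Tji Tjj).
apply/setP=> I; apply/idP/imsetP => [/lift_of_in_chain TI|[i _ ->]]; last first.
  by have [[]] := hG i.
have le1 : le_fun (lift_of I) (shift (lift_of I) 1) by move=> x; rewrite /shift; lia.
have ne1 : lift_of I <> shift (lift_of I) 1.
  by move/(congr1 (@total n)); rewrite total_shift; have := n0; lia.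
have [i [Ti _]] := chain_step kn hT TI (chain_shift hT 1 TI) le1 ne1.
have [Tg Tgi] := hG i; exists i => //.
have [c ->] := chain_step_shift kn hT TI Ti Tg Tgi.
by rewrite ksub_shift ksub_lift_of.
Qed.

(** [W] is the fourth corner of a unit square whose other three corners are consecutive in [T]. *)
Definition flip W := exists g i j,
  [/\ T g, T (step g i), T (step (step g i) j),
      i != j /\ is_lift k (step g j) & ksub I0 (step g j) = W].

Lemma flip_not_in_chain g i j : i != j -> T (step g i) -> ~ T (step g j).
Proof. by move=> ij Ti Tj; case/eqP: ij; apply: (chain_step_unique kn hT Ti Tj). Qed.

Lemma flip_notin W : flip W -> W \notin J.
Proof.
move=> [g [i [j [Tg Ti Tij [ij lj] <-]]]].
by apply/negP => h; apply: (flip_not_in_chain ij Ti); split.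
Qed.

Lemma second_largest_flip W : t_largest_minor R 2 J W -> flip W.
Proof.
move=> /(second_largest_minorP R J W le_kn)[A [hA eJ nW hW]].
pose F g := minor A (ksub I0 g).
have Fpos g : is_lift k g -> 0 < F g by case: hA => _ h _; apply: h.
have [g0 Tg0] := chain_inhabited hT.
have FT g : T g -> F g = F g0.
  move=> [_ gJ]; apply/le_anti; case: Tg0 => _ g0J.
  by move: gJ g0J; rewrite -eJ => /argmax_minorsP h /argmax_minorsP h0; rewrite h0 h.
have Fm g : F g <= F g0.
  by case: Tg0 => _; rewrite -eJ => /argmax_minorsP; apply.
have lw := is_lift_of W.
have nw : ~ T (lift_of W) by move/lift_of_in_chain => h; rewrite h in nW.
have [g [i [j [Tg Ti Tij wi wj]]]] := chain_wall kn hT lw nw.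
have ij := wall_neq wi wj; have lj := wall_lift hT Tg Tij lw wi wj.
have [_ hlt] := wall_le kn Fpos (minor_supermodular I0 kn hA) hT FT Tg Tij lw wi wj (fun h _ => Fm h).
exists g, i, j; split=> //; case: (pselect (lift_of W = step g j)) => [<-|/hlt].
  exact: ksub_lift_of.
have nV : ksub I0 (step g j) \notin J.
  by apply/negP => h; apply: (flip_not_in_chain ij Ti).
by rewrite /F ksub_lift_of // ltNge hW.
Qed.

(** Up to shift, every element of [T] other than [step g i] lies below [g] or above
    [step (step g i) j], and the flip lies between these two. *)
Lemma flip_comparable g i j t : T g -> T (step g i) -> T (step (step g i) j) ->
  T t -> ksub I0 t != ksub I0 (step g i) -> comparable_fun (step g j) t.
Proof.
move=> Tg Ti Tij Tt ne.
have le2 : le_fun (step g j) (step (step g i) j) by rewrite stepC; apply: le_step.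
case: (chain_comparable hT Tt Tg) => [tg|gt].
  by right; apply: le_fun_trans tg (le_step _ _).
case: (chain_comparable hT Tt Tij) => [ts|st]; last by left; apply: le_fun_trans le2 st.
have ge : comparable_fun (step g j) g by right; apply: le_step.
case: (chain_comparable hT Tt Ti) => [ti|it].
  by case: (between_step gt ti) ne => [->|->]; rewrite ?eqxx.
by case: (between_step it ts) ne => [->|->]; rewrite ?eqxx // => _; left.
Qed.

Lemma flip_collection W : flip W -> exists Q,
  [/\ sorted_collection Q, #|Q| = n, #|Q :&: J| = n.-1 & W \in Q].
Proof.
move=> fW; have nW := flip_notin fW.
move: fW => [g [i [j [Tg Ti Tij [ij lj] eW]]]].
have iJ : ksub I0 (step g i) \in J by case: Ti.
pose Q := W |: (J :\ ksub I0 (step g i)).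
have QJ : Q :&: J = J :\ ksub I0 (step g i).
  apply/setP=> I; rewrite !inE; case: (eqVneq I W) => [->|_] /=.
    by rewrite (negPf nW) andbF.
  by rewrite -andbA andbb.
have cQJ : #|Q :&: J| = n.-1.
  by have := cardsD1 (ksub I0 (step g i)) J; rewrite iJ QJ card_maxset_sorted add1n => /(congr1 predn) /esym.
have cQ : #|Q| = n.
  rewrite cardsU1 in_setD1 (negPf nW) andbF /= -QJ cQJ; lia.
have sQ : sorted_collection Q.
  apply/(sorted_collectionP I0 kn).
  have shiftW p : is_lift k p -> ksub I0 p = W -> exists c, p = shift (step g j) c.
    by move=> lp e; apply: (ksub_eq_shift (I0 := I0) kn lj lp); rewrite e eW.
  have key p q : is_lift k p -> ksub I0 p = W -> lifts I0 Q q -> comparable_fun p q.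
    move=> lp /(shiftW _ lp)[c ->] [lq]; rewrite in_setU1 in_setD1.
    case/orP => [/eqP /(shiftW _ lq)[d ->]|/andP[ne qJ]].
      case: (lerP c d) => cd; [left|right] => x; rewrite /shift; lia.
    have Tq : T (shift q (- c)) by apply: (chain_shift hT); split.
    have := flip_comparable Tg Ti Tij Tq; rewrite ksub_shift => /(_ ne).
    by case=> h; [left|right] => x; move: (h x); rewrite /shift; lia.
  move=> p q Tp Tq; have [lp] := Tp; rewrite in_setU1 => /orP[/eqP pW|].
    exact: key.
  rewrite in_setD1 => /andP[_ pJ].
  have [lq] := Tq; rewrite in_setU1 => /orP[/eqP qW|].
    by apply: comparable_funC; apply: key.
  by rewrite in_setD1 => /andP[_ qJ]; apply: (chain_comparable hT); split.
by exists Q; rewrite setU11.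
Qed.

(** At the place where [W] straddles [T], the middle element [step g i] is incomparable to [W], so
    it is the one element of [J] missing from [Q]. Its neighbours in [T] are then in [Q] and
    comparable to [W], which squeezes [W] between them and makes it the flip. *)
Lemma adjacent_flip Q W : sorted_collection Q -> #|Q| = n ->
  #|Q :&: J| = n.-1 -> W \in Q -> W \notin J ->
  flip W /\ Q = W |: [set I in J | sorted_pair I W].
Proof.
move=> hQ cQ cQJ WQ nW; have /(sorted_collectionP I0 kn) sQ := hQ.
have lw := is_lift_of W.
have nw : ~ T (lift_of W) by move/lift_of_in_chain => h; rewrite h in nW.
have [g [i [j [Tg Ti Tij wi wj]]]] := chain_wall kn hT lw nw.
have ij := wall_neq wi wj; have lj := wall_lift hT Tg Tij lw wi wj.
have lg := chain_lift hT Tg; have li := chain_lift hT Ti; have lij := chain_lift hT Tij.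
have inc : ~ comparable_fun (step g i) (lift_of W).
  by case=> [/(_ i)|/(_ j)]; [rewrite step_self; lia|lia].
have LW : lifts I0 Q (lift_of W) by split=> //; rewrite ksub_lift_of.
have niQ : ksub I0 (step g i) \notin Q.
  by apply/negP => h; apply: inc; apply: sQ.
have iJ : ksub I0 (step g i) \in J by case: Ti.
have QJ : Q :&: J = J :\ ksub I0 (step g i).
  apply/eqP; rewrite eqEcard; apply/andP; split.
    apply/subsetP => I; rewrite !inE => /andP[IQ ->]; rewrite andbT.
    by apply: contraNneq niQ => <-.
  by have := cardsD1 (ksub I0 (step g i)) J; rewrite iJ cQJ card_maxset_sorted add1n => /(congr1 predn) /= <-.
have inQ t : T t -> ksub I0 t != ksub I0 (step g i) -> lifts I0 Q t.
  move=> [lt tJ] ne; split=> //.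
  have : ksub I0 t \in J :\ ksub I0 (step g i) by rewrite in_setD1 ne tJ.
  by rewrite -QJ inE => /andP[].
have Qg : lifts I0 Q g by apply: inQ; rewrite // eq_sym; apply: ksub_step_neq.
have Qs : lifts I0 Q (step (step g i) j) by apply: inQ => //; apply: ksub_step_neq.
have wE : lift_of W = step g j.
  rewrite -(wall_clamp wi wj).
  have ws : le_fun (lift_of W) (step (step g i) j).
    case: (sQ _ _ LW Qs) => // /(_ i); rewrite {1}/step step_self; lia.
  have gw : le_fun g (lift_of W).
    case: (sQ _ _ Qg LW) => // /(_ j); have := le_step g i j; lia.
  by rewrite meet_fun_l // join_funC join_fun_r.
have fW : flip W by exists g, i, j; split=> //; rewrite -wE ksub_lift_of.
split=> //; apply/setP=> I; rewrite in_setU1 inE.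
have QW : Q :&: J = Q :\ W.
  apply/eqP; rewrite eqEcard; apply/andP; split.
    apply/subsetP => I'; rewrite !inE => /andP[-> I'J]; rewrite andbT.
    by apply: contraNneq nW => <-.
  by have := cardsD1 W Q; rewrite WQ cQ cQJ add1n => /(congr1 predn) /= <-.
case: (eqVneq I W) => [-> //|IW] /=.
apply/idP/andP => [IQ|[IJ sIW]].
  have : I \in Q :\ W by rewrite in_setD1 IW.
  rewrite -QW inE => /andP[_ ->]; split=> //.
  by move/forallP: hQ => /(_ I)/implyP/(_ IQ)/forallP/(_ W)/implyP; apply.
have : I \in J :\ ksub I0 (step g i).
  rewrite in_setD1 IJ andbT; apply/eqP => eI; apply: inc.
  have := iffLR (sorted_pair_comparable I W n0) sIW; apply=> //.
    by rewrite eI val_ksub.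
  exact: supp_lift_of.
by rewrite -QJ inE => /andP[].
Qed.

(** A flip is determined by the coordinate [i]: the step at [i] is unique up to shift, and the step
    [j] after it is unique. *)
Lemma card_flips (S : {set ksubset k n}) : (forall W, W \in S -> flip W) -> (#|S| <= n)%N.
Proof.
move=> hS.
have ex i : exists W, forall g j, T g -> T (step g i) -> T (step (step g i) j) ->
    ksub I0 (step g j) = W.
  have [g [Tg Ti]] := chain_step_exists kn hT i.
  have le1 : le_fun (step g i) (shift (step g i) 1) by move=> x; rewrite /shift; lia.
  have ne1 : step g i <> shift (step g i) 1.
    by move/(congr1 (@total n)); rewrite total_shift; have := n0; lia.
  have [j [Tij _]] := chain_step kn hT Ti (chain_shift hT 1 Ti) le1 ne1.
  exists (ksub I0 (step g j)) => h l Th Thi Thil.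
  have [c e] := chain_step_shift kn hT Tg Ti Th Thi.
  have := chain_shift hT c Tij; rewrite !shift_step -e => Thij.
  by rewrite (chain_step_unique kn hT Thil Thij) e -shift_step ksub_shift.
have [psi hpsi] := choice ex.
rewrite -[X in (_ <= X)%N]card_ord; apply: leq_trans (leq_imset_card psi _).
apply: subset_leq_card; apply/subsetP => W /hS[g [i [j [Tg Ti Tij _ <-]]]].
by rewrite (hpsi i g j) // imset_f.
Qed.

(** Three corners of the square have minor [m], so the exchange relation determines the minor at the
    fourth. *)
Lemma flip_ratio g i j : i != j -> T g -> T (step g i) -> T (step (step g i) j) ->
  is_lift k (step g j) ->
  uniq [:: i; j; ord_pred i; ord_pred j] /\
  forall (u tau : 'I_n -> R) (m : R),
    Gr_pos (vandermonde k u) -> m != 0 ->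
    (forall t, T t -> minor (rescale (vandermonde k u) tau) (ksub I0 t) = m) ->
    minor (rescale (vandermonde k u) tau) (ksub I0 (step g j)) *
      `|(u j - u i) * (u (ord_pred j) - u (ord_pred i))| =
    m * `|(u (ord_pred j) - u i) * (u j - u (ord_pred i))|.
Proof.
move=> ij Tg Ti Tij lj.
have [hu hC [e1 e2] e3 e4] :=
  square_sets I0 kn ij (chain_lift hT Tg) (chain_lift hT Ti) lj.
split=> // u tau m hA m0 hm; apply: (mulIf m0).
have := minor_rescaled_vandermonde_ratio tau le_kn hu hC e1 e2 e3 e4 hA.
by rewrite /= (hm _ Tg) (hm _ Ti) (hm _ Tij) => E; rewrite mulrAC E; ring.
Qed.

(** Nodes are chosen to give this flip the largest cross-ratio, and columns are rescaled to make [J]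
    largest. Any other minor outside [J] is bounded by the flip at its own wall, which in turn is
    bounded by the chosen one. *)
Lemma flip_second_largest W : flip W -> t_largest_minor R 2 J W.
Proof.
move=> fW; have nW := flip_notin fW.
move: fW => [g [i [j [Tg Ti Tij [ij lj] eW]]]].
have [hu hF] := flip_ratio ij Tg Ti Tij lj.
have [u [uinc umax]] := exists_exchange_maximal R hu.
have hA := Gr_pos_vandermonde le_kn uinc.
have [tau [hB eJ [m hm]]] := largest_of_chain hA.
have Bpos I : 0 < minor (rescale (vandermonde k u) tau) I by case: hB.
have m0 : 0 < m by rewrite -(hm g Tg).
have upos c d x y : uniq [:: c; d; x; y] -> 0 < `|(u d - u c) * (u y - u x)|.
  move=> /= /and4P[]; rewrite !inE !negb_or => /andP[cd _] _ xy _.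
  have une s t : s != t -> u t - u s != 0.
    rewrite subr_eq0 -(inj_eq val_inj) neq_ltn => /orP[] /uinc /= h.
      by rewrite gt_eqF.
    by rewrite lt_eqF.
  by rewrite normr_gt0 mulf_neq0 ?une.
apply/(second_largest_minorP R J W le_kn); exists (rescale (vandermonde k u) tau); split=> //.
move=> I nI; rewrite -(ksub_lift_of I0 kn I).
have lw := is_lift_of I.
have nw : ~ T (lift_of I) by move/lift_of_in_chain => h; rewrite h in nI.
have [g' [c [d [Tg' Tc Tcd wc wd]]]] := chain_wall kn hT lw nw.
have cd := wall_neq wc wd; have ld := wall_lift hT Tg' Tcd lw wc wd.
have Fm h : is_lift k h -> minor (rescale (vandermonde k u) tau) (ksub I0 h) <= m.
  move=> _; rewrite -(hm g Tg); case: Tg => _; rewrite -eJ => /argmax_minorsP; exact.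
have [le_w _] := wall_le kn (fun h _ => Bpos (ksub I0 h)) (minor_supermodular I0 kn hB)
  hT hm Tg' Tcd lw wc wd Fm.
apply: le_trans le_w _; rewrite -eW.
have [hu' hF'] := flip_ratio cd Tg' Tc Tcd ld.
have E := hF u tau m hA (lt0r_neq0 m0) hm; have E' := hF' u tau m hA (lt0r_neq0 m0) hm.
have K := upos _ _ _ _ hu; have K' := upos _ _ _ _ hu'.
have := umax c d hu'; rewrite /exchange_ratio_le.
exact: (le_of_cross_products m0 K' K E' E).
Qed.

End MaximalSorted.

(** [J] is sorted, hence contained in a maximal sorted collection; rescaling realizes the latter as
    largest minors, so maximality of [J] makes them equal. *)
Lemma maximal_largest_maxset J : maximal_largest_arrangement R J ->
  maxset (@sorted_collection k n) J.
Proof.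
move=> [/(largest_arrangementP R J le_kn)[A [hA eJ]] mJ].
have sJ : sorted_collection J by rewrite -eJ; apply: sorted_argmax.
have [J' mJ' JJ'] := maxset_exists sJ.
have [tau [hB eB _]] := largest_of_chain mJ' hA.
have lJ' : largest_arrangement R J'.
  by apply/(largest_arrangementP R J' le_kn); exists (rescale A tau).
by rewrite -(mJ J' lJ' JJ').
Qed.

(** A sorted collection of [n] elements is maximal, because any maximal one containing it has [n]
    elements too. *)
Lemma Gamma_adjP Q J : maxset (@sorted_collection k n) J ->
  Gamma_adj Q J <-> [/\ sorted_collection Q, #|Q| = n & #|Q :&: J| = n.-1].
Proof.
move=> mJ; have cJ := card_maxset_sorted mJ.
rewrite /Gamma_adj !inE mJ /=; split=> [/and3P[mQ _ /eqP cQJ]|[sQ cQ cQJ]].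
  by split; rewrite ?(card_maxset_sorted mQ) //; case/maxsetP: mQ.
have [Q' mQ' QQ'] := maxset_exists sQ.
have mQ : maxset (@sorted_collection k n) Q.
  suff -> : Q = Q' by [].
  by apply/eqP; rewrite eqEcard QQ' cQ (card_maxset_sorted mQ') leqnn.
rewrite mQ cQJ eqxx andbT /=; apply/eqP => e.
by move: cQJ; rewrite e setIid cJ; have := n0; lia.
Qed.

Lemma adjacent_notin Q J : maxset (@sorted_collection k n) J -> Gamma_adj Q J ->
  exists2 W, W \in Q & W \notin J.
Proof.
move=> mJ; rewrite /Gamma_adj !inE => /and4P[mQ _ QJ _].
have /subsetPn[W WQ nW] : ~~ (Q \subset J); last by exists W.
apply: contraNN QJ => sub; apply/eqP/esym.
by case/maxsetP: mQ => _ /(_ J); apply=> //; case/maxsetP: mJ.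
Qed.

Lemma incident_edgesP J e : maxset (@sorted_collection k n) J ->
  reflect (exists2 Q, Gamma_adj Q J & e = [set J; Q]) (e \in incident_edges J).
Proof.
move=> mJ.
have adjC Q Q' : Gamma_adj Q Q' -> Gamma_adj Q' Q.
  by rewrite /Gamma_adj => /and4P[-> -> ne c]; rewrite eq_sym ne setIC c.
rewrite inE; apply: (iffP andP) => [[/imsetP[[Q1 Q2] /=]]|[Q adj ->]].
  rewrite inE /= => adj -> /set2P[eJ|eJ].
    by exists Q2; rewrite eJ //; apply: adjC.
  by exists Q1; rewrite eJ // setUC.
split; last by rewrite set21.
by apply/imsetP; exists (J, Q); rewrite ?inE //=; apply: adjC.
Qed.

Lemma second_largest_facets J (hJ : maximal_largest_arrangement R J) :
  [/\ forall W : ksubset k n, W \notin J ->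
        (t_largest_minor R 2 J W <->
         exists Q : {set ksubset k n},
           [/\ Q \in Gamma_vertices k n, Gamma_adj Q J & W \in Q]),
      (exists f : ksubset k n -> {set {set ksubset k n}},
         [/\ {in t_largest_minors R 2 J &, injective f},
             f @: t_largest_minors R 2 J = incident_edges J
           & forall W : ksubset k n, W \in t_largest_minors R 2 J ->
               exists2 Q : {set ksubset k n}, f W = [set J; Q] & W \in Q])
    & (#|t_largest_minors R 2 J| <= n)%N].
Proof.
have mJ := maximal_largest_maxset hJ.
have second_flip W : t_largest_minor R 2 J W <-> flip J W.
  by split; [apply: second_largest_flip|apply: flip_second_largest].
have mem_second W : (W \in t_largest_minors R 2 J) <-> flip J W.
  by rewrite inE -second_flip; split=> /asboolP.
(* The adjacent vertex containing [W] can only be this collection, which makes the correspondence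
   between minors and edges a function. *)
pose Qof W := W |: [set I in J | sorted_pair I W].
have adj_flip Q W : Gamma_adj Q J -> W \in Q -> W \notin J -> flip J W /\ Q = Qof W.
  by move=> /(Gamma_adjP _ mJ)[sQ cQ cQJ]; apply: adjacent_flip.
have flip_adj W : flip J W -> Gamma_adj (Qof W) J.
  move=> fW; have nW := flip_notin mJ fW.
  have [Q [sQ cQ cQJ WQ]] := flip_collection mJ fW.
  have adj : Gamma_adj Q J by apply/(Gamma_adjP _ mJ).
  by have [_ <-] := adj_flip Q W adj WQ nW.
split.
- move=> W nW; rewrite second_flip; split=> [fW|[Q [_ adj WQ]]].
    exists (Qof W); rewrite setU11 flip_adj //; split=> //.
    by have := flip_adj W fW; rewrite /Gamma_adj => /and4P[].
  by have [] := adj_flip Q W adj WQ nW.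
- exists (fun W => [set J; Qof W]); split.
  + move=> W W' /mem_second fW /mem_second fW' e.
    have nW := flip_notin mJ fW.
    have /set2P[eJ|eQ] : Qof W \in [set J; Qof W'] by rewrite -e set22.
      by rewrite -eJ setU11 in nW.
    have : W \in Qof W' by rewrite -eQ setU11.
    by rewrite in_setU1 inE (negPf nW) orbF => /eqP.
  + apply/setP=> e; apply/imsetP/(incident_edgesP _ mJ) => [[W /mem_second fW ->]|[Q adj ->]].
      by exists (Qof W) => //; apply: flip_adj.
    have [W WQ nW] := adjacent_notin mJ adj; have [fW ->] := adj_flip Q W adj WQ nW.
    by exists W => //; apply/mem_second.
  + by move=> W _; exists (Qof W); rewrite ?setU11.
by apply: (card_flips mJ) => W /mem_second.
Qed.

End Facets.

Theorem theorem4p8 (R : realType) (k n : nat) (hk : (1 <= k)%N) (hkn : (k <= n)%N)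
    (J : {set ksubset k n}) (hJ : maximal_largest_arrangement R J) :
  [/\ forall W : ksubset k n, W \notin J ->
        (t_largest_minor R 2 J W <->
         exists Q : {set ksubset k n},
           [/\ Q \in Gamma_vertices k n, Gamma_adj Q J & W \in Q]),
      (exists f : ksubset k n -> {set {set ksubset k n}},
         [/\ {in t_largest_minors R 2 J &, injective f},
             f @: t_largest_minors R 2 J = incident_edges J
           & forall W : ksubset k n, W \in t_largest_minors R 2 J ->
               exists2 Q : {set ksubset k n}, f W = [set J; Q] & W \in Q])
    & (#|t_largest_minors R 2 J| <= n)%N].
Proof.
have [I0 _] := exists_ksubset hkn.
move: hkn; rewrite leq_eqVlt => /orP[/eqP ekn|kn]; last first.
  by apply: second_largest_facets => //; rewrite hk.
have hkn : (k <= n)%N by rewrite ekn.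
(* For [k = n] the full set is the only subset: [J] contains it, there are no second largest minors,
   and the graph has no edges. *)
have allE (I I' : ksubset k n) : I = I'.
  have full (X : ksubset k n) : val X = [set: 'I_n].
    by apply/eqP; rewrite eqEcard subsetT cardsT card_ord card_ksubset ekn leqnn.
  by apply: val_inj; rewrite !full.
have inJ I : I \in J.
  have [/(largest_arrangementP R J hkn)[A [_ <-]] _] := hJ.
  by apply/argmax_minorsP => I'; rewrite (allE I' I).
have S0 : t_largest_minors R 2 J = set0.
  apply/setP=> W; rewrite !inE; apply/asboolP => /(second_largest_minorP R J W hkn)[A [_ _]].
  by rewrite inJ.
split; first by move=> W; rewrite inJ.
- exists (fun=> set0); rewrite S0; split.
  + by move=> W; rewrite inE.
  + rewrite imset0; apply/esym/setP=> e; rewrite !inE; apply/negP => /andP[/imsetP[[Q Q'] /=]].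
    rewrite inE /= /Gamma_adj => /and4P[]; rewrite !inE => mQ mQ' ne _ _ _.
    have sub (X Y : {set ksubset k n}) : X != set0 -> Y \subset X.
      by case/set0Pn=> I XI; apply/subsetP => I' _; rewrite (allE I' I).
    have max_eq (X Y : {set ksubset k n}) : maxset (@sorted_collection k n) X ->
        maxset (@sorted_collection k n) Y -> X \subset Y -> Y = X.
      by move=> /maxsetP[_ mX] /maxsetP[sY _]; apply: mX.
    case: (eqVneq Q set0) => [Q0|Q0].
      by case/eqP: ne; rewrite (max_eq Q Q') // Q0 sub0set.
    by case/eqP: ne; rewrite -(max_eq Q' Q) // sub.
  + by move=> W; rewrite inE.
by rewrite S0 cards0.
Qed.
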